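(* There exists a sequence of quadratic transforms along $\nu^*$ $$S=S_0\to S_1\to\cdots\to S_{k_1-1}\to S_{k_1}\to S_{k_1+1}\to\cdots\to S_{k_i}\to\cdots$$ such that for all $i>0$, $S_{k_i}$ is free and has a system of regular parameters $(x_i,y_i)$ such that $x_i$ is an exceptional parameter, $T_j=x_i^{Q_i\beta_j}\gamma_{j,i}$ for $0\le j\le i$ with $\gamma_{j,i}\in S_{k_i}$ a unit, $\nu^*(x_i)=\frac1{Q_i}$, $y_i=\frac{T_{i+1}}{\prod_{j=0}^{i-1}T_j^{n_{i,j}}}$ is the strict transform of $T_{i+1}$ in $S_{k_i}$, and $\nu^*(y_i)=\frac1{Q_i}\cdot\frac{p_{i+1}}{q_{i+1}}$.
   Context: Setting: $k$ (the base field) is algebraically closed of characteristic $0$; $\nu^*$ is a $k$-valuation of a function field $K^*$ of transcendence degree $2$ with valuation ring $V^*$, value group a subgroup of $\mathbb{Q}$ and residue field $k$; $S$ is an algebraic two-dimensional regular local ring with quotient field $K^*$ dominated by $V^*$, with regular parameters $(x,y)$, and $\nu^*(x)=1$. A quadratic transform along $\nu^*$ of a two-dimensional regular local ring $A$ with regular parameters $(a_1,a_2)$ is $A[m_A/a_i]$ localized at its intersection with $m_{V^*}$, chosen so it is dominated by $V^*$. Let $E$ be the curve $x=0$ on $\operatorname{Spec}S$; for $S_j$ in the sequence with $\pi_j:\operatorname{Spec}S_j\to\operatorname{Spec}S$, $S_j$ is free if $\pi_j^{-1}(E)_{\mathrm{red}}$ has exactly one irreducible component, and a regular parameter of a free $S_j$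 is exceptional if it is supported on $\pi_j^{-1}(E)_{\mathrm{red}}$. Jumping polynomials: $T_0=x$, $T_1=y$, $q_0=\infty$, $p_1,q_1$ coprime positive integers with $\nu^*(y)=p_1/q_1$; for $i\ge1$, $n_{i,j}$ ($0\le j<i$) are nonnegative integers with $n_{i,j}<q_j$ and $q_i\nu^*(T_i)=\sum_{j<i}n_{i,j}\nu^*(T_j)$, $\lambda_i\in k$ is the residue of $T_i^{q_i}/\prod_{j<i}T_j^{n_{i,j}}$, $T_{i+1}=T_i^{q_i}-\lambda_i\prod_{j<i}T_j^{n_{i,j}}$, and $p_{i+1},q_{i+1}$ are coprime positive integers with $\nu^*(T_{i+1})=q_i\nu^*(T_i)+\frac{1}{q_1\cdots q_i}\frac{p_{i+1}}{q_{i+1}}$. Put $\beta_i=\nu^*(T_i)$, $Q_i=q_1\cdots q_i$. For coprime positive $p,q$, $\epsilon(p,q)$ is the sum $f_1+\cdots+f_N$ of the quotients in the Euclidean algorithm $r_0=p$, $r_1=q$, $r_{j-1}=f_jr_j+r_{j+1}$. Set $k_0=0$, $k_i=k_{i-1}+\epsilon(p_i,q_i)$. *)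

(* Defs.v *)
From HB Require Import structures.
From mathcomp Require Import all_boot all_order all_algebra.
Set Implicit Arguments. Unset Strict Implicit. Unset Printing Implicit Defensive.
Import Order.TTheory GRing.Theory Num.Theory.

(* epsilon(p,q): sum of the quotients in the Euclidean algorithm
   r0 = p, r1 = q, r_{j-1} = f_j r_j + r_{j+1}, stopping when the remainder is 0.
   The fuel q.+1 suffices since the divisor strictly decreases. *)
Fixpoint eps_rec (fuel p q : nat) : nat :=
  match fuel with
  | 0 => 0
  | fuel'.+1 => if q == 0 then 0 else p %/ q + eps_rec fuel' q (p %% q)
  end.
Definition eps (p q : nat) : nat := eps_rec q.+1 p q.

Fixpoint kseq (p q : nat -> nat) (i : nat) : nat :=
  match i with
  | 0 => 0
  | i'.+1 => kseq p q i' + eps (p i'.+1) (q i'.+1)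
  end.

Definition Qprod (q : nat -> nat) (i : nat) : nat := \prod_(1 <= j < i.+1) q j.

Section Defs.
Local Open Scope ring_scope.
Variables (k K : fieldType) (f : {rmorphism k -> K}) (nu : K -> rat).

Definition inV (z : K) : Prop := z = 0 \/ 0 <= nu z.
Definition inmV (z : K) : Prop := z = 0 \/ 0 < nu z.

(* nu is a k-valuation (values in Q) on K; its values on 0 are irrelevant *)
Definition is_k_valuation : Prop :=
  (forall a b : K, a != 0 -> b != 0 -> nu (a * b) = nu a + nu b) /\
  (forall a b : K, a != 0 -> b != 0 -> a + b != 0 ->
      Num.min (nu a) (nu b) <= nu (a + b)) /\
  (forall c : k, c != 0 -> nu (f c) = 0).

Definition residue_field_k : Prop :=
  forall z : K, inV z -> exists c : k, inmV (z - f c).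

Definition subring (A : K -> Prop) : Prop :=
  A 0 /\ A 1 /\ (forall a b, A a -> A b -> A (a - b)) /\
  (forall a b, A a -> A b -> A (a * b)).

Definition unitIn (A : K -> Prop) (z : K) : Prop := A z /\ z != 0 /\ A z^-1.

Definition maxid (A : K -> Prop) (z : K) : Prop := A z /\ ~ unitIn A z.

Definition ideal (A I : K -> Prop) : Prop :=
  (forall z, I z -> A z) /\ I 0 /\ (forall a b, I a -> I b -> I (a + b)) /\
  (forall r a, A r -> I a -> I (r * a)).

Definition local_ring (A : K -> Prop) : Prop := subring A /\ ideal A (maxid A).

Definition prime_ideal (A P : K -> Prop) : Prop :=
  ideal A P /\ ~ P 1 /\ (forall a b, A a -> A b -> P (a * b) -> P a \/ P b).

Definition fingen (A I : K -> Prop) : Prop :=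
  exists s : seq K, forall z, I z <->
    exists r : nat -> K, (forall j, A (r j)) /\ z = \sum_(j < size s) r j * s`_j.

Definition noetherian (A : K -> Prop) : Prop :=
  forall I, ideal A I -> fingen A I.

Definition sincl (P Q : K -> Prop) : Prop :=
  (forall z, P z -> Q z) /\ exists z, Q z /\ ~ P z.

Definition krull_dim2 (A : K -> Prop) : Prop :=
  (exists P0 P1 P2, prime_ideal A P0 /\ prime_ideal A P1 /\ prime_ideal A P2 /\
      sincl P0 P1 /\ sincl P1 P2) /\
  ~ (exists P0 P1 P2 P3, prime_ideal A P0 /\ prime_ideal A P1 /\
      prime_ideal A P2 /\ prime_ideal A P3 /\
      sincl P0 P1 /\ sincl P1 P2 /\ sincl P2 P3).

Definition reg_params (A : K -> Prop) (a1 a2 : K) : Prop :=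
  local_ring A /\ noetherian A /\ krull_dim2 A /\
  maxid A a1 /\ maxid A a2 /\
  (forall z, maxid A z <-> exists r s, A r /\ A s /\ z = r * a1 + s * a2).

Definition frac_field_is_K (A : K -> Prop) : Prop :=
  forall z : K, exists a b, A a /\ A b /\ b != 0 /\ z = a / b.

Inductive kalg (s : seq K) : K -> Prop :=
  | kalg_const c : kalg s (f c)
  | kalg_gen z : z \in s -> kalg s z
  | kalg_add a b : kalg s a -> kalg s b -> kalg s (a + b)
  | kalg_mul a b : kalg s a -> kalg s b -> kalg s (a * b).

Definition algebraic_ring (A : K -> Prop) : Prop :=
  exists (s : seq K) (P : K -> Prop), prime_ideal (kalg s) P /\
    forall z, A z <-> exists a b, kalg s a /\ kalg s b /\ ~ P b /\ z = a / b.

Definition eval2 (t1 t2 : K) (P : {poly {poly k}}) : K :=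
  (map_poly (fun c : {poly k} => (map_poly f c).[t1]) P).[t2].

Definition trdeg2 : Prop :=
  exists t1 t2 : K,
    (forall P : {poly {poly k}}, eval2 t1 t2 P = 0 -> P = 0) /\
    (forall z : K, exists P : {poly K}, P != 0 /\ root P z /\
       forall i, exists a b, kalg [:: t1; t2] a /\ kalg [:: t1; t2] b /\
                             b != 0 /\ P`_i = a / b).

Definition dominated (A : K -> Prop) : Prop :=
  (forall z, A z -> inV z) /\ (forall z, maxid A z -> inmV z).

Definition adjoin (A : K -> Prop) (t z : K) : Prop :=
  exists (c : nat -> K) (d : nat), (forall j, A (c j)) /\
    z = \sum_(j < d) c j * t ^+ j.

Definition qt_chart (A : K -> Prop) (a1 a2 : K) (B : K -> Prop) : Prop :=
  inV (a2 / a1) /\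
  forall z, B z <-> exists r s, adjoin A (a2 / a1) r /\ adjoin A (a2 / a1) s /\
                                ~ inmV s /\ z = r / s.

Definition quad_transform (A B : K -> Prop) : Prop :=
  exists a1 a2, reg_params A a1 a2 /\ (qt_chart A a1 a2 B \/ qt_chart A a2 a1 B).

(* P is a minimal prime of B containing x, i.e. an irreducible component
   of V(xB) = pi^{-1}(E) *)
Definition minprime (B : K -> Prop) (x : K) (P : K -> Prop) : Prop :=
  prime_ideal B P /\ P x /\
  forall Q, prime_ideal B Q -> Q x -> (forall z, Q z -> P z) ->
            forall z, P z -> Q z.

Definition is_free (B : K -> Prop) (x : K) : Prop :=
  exists P, minprime B x P /\
    forall Q, minprime B x Q -> forall z, Q z <-> P z.

(* V(u) is contained in pi^{-1}(E)_red *)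
Definition supported_on_E (B : K -> Prop) (x u : K) : Prop :=
  forall P, prime_ideal B P -> P u -> P x.

Definition exceptional_param (B : K -> Prop) (x u : K) : Prop :=
  (exists v, reg_params B u v \/ reg_params B v u) /\ supported_on_E B x u.

Definition dividesIn (B : K -> Prop) (d g : K) : Prop := exists h, B h /\ g = d * h.

Definition strict_transform (B : K -> Prop) (x F G : K) : Prop :=
  B G /\ (exists h, B h /\ h != 0 /\ supported_on_E B x h /\ F = h * G) /\
  (forall d, B d -> ~ unitIn B d -> dividesIn B d G -> ~ supported_on_E B x d).

Definition jumping (x y : K) (T : nat -> K) (p q : nat -> nat)
    (n : nat -> nat -> nat) (lam : nat -> k) : Prop :=
  T 0 = x /\ T 1 = y /\
  (forall i, (0 < i)%N -> (0 < p i)%N /\ (0 < q i)%N /\ coprime (p i) (q i)) /\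
  nu y = (p 1)%:R / (q 1)%:R /\
  (forall i, (0 < i)%N ->
     (forall j, (0 < j < i)%N -> (n i j < q j)%N) /\
     (q i)%:R * nu (T i) = \sum_(j < i) (n i j)%:R * nu (T j) /\
     inmV (T i ^+ q i / (\prod_(j < i) T j ^+ n i j) - f (lam i)) /\
     T i.+1 = T i ^+ q i - f (lam i) * \prod_(j < i) T j ^+ n i j /\
     nu (T i.+1) = (q i)%:R * nu (T i) +
                   ((Qprod q i)%:R)^-1 * ((p i.+1)%:R / (q i.+1)%:R)).

End Defs.

(* Main.v *)
(** Quasi-regularity of the parameters (a, b) identifies A[b/a]/(a) with a polynomial ring over k,
    so a quadratic transform of a regular local ring of dimension two is again one: it is
    noetherian by Hilbert's basis theorem, its parameter a is prime, and its dimension is bounded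
    by a relative form of Krull's principal ideal theorem.  From a free S_{k_i} with parameters
    (x_i, y_i) of values in the ratio q_{i+1} : p_{i+1}, the Euclidean algorithm on that pair
    is mirrored by quadratic transforms that divide one parameter by the other; they end at
    parameters u, v of equal value with y_i^q / x_i^p = v / u.  Since T_0, ..., T_i are monomials in
    x_i times units and T_{i+1} is y_i times such a monomial, T_{i+1}^q / prod_j T_j^n_j is a unit
    times v / u, and subtracting its residue gives the new parameter y_{i+1} at the centre of the
    last transform. *)
Require Import Defs.
From HB Require Import structures.
From mathcomp Require Import all_boot all_order all_algebra.
From mathcomp Require Import ring lra zify.
From Stdlib Require Import Classical ClassicalEpsilon.
Import Order.TTheory GRing.Theory Num.Theory.
Set Implicit Arguments. Unset Strict Implicit. Unset Printing Implicit Defensive.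
Local Open Scope ring_scope.

(** * Subrings and ideals of a field *)

(** All rings are predicates on the one field [K], so inclusions along a chain of transforms are
    literal, but a quotient [A / J] is not one of them: statements about it are phrased for ideals
    of [A] containing [J], and [adj J a] stands for [J + aA]. The obstacle is that [reg_params]
    includes a condition on chains of primes, so every transform must be shown anew to have
    dimension exactly two; [reg_params_intro] reduces this to one generator of the maximal ideal
    being a nonzero prime that does not divide the other. The number of transforms comes out exactly
    because a sum of Euclidean quotients counts subtractions; the last one, at the pair (1, 1), is
    the transform whose centre is given by [lam]. *)

Section Subring.
Variables (K : fieldType) (A : K -> Prop).
Hypothesis sA : subring A.

Lemma sr0 : A 0. Proof. by case: sA. Qed.
Lemma sr1 : A 1. Proof. by case: sA => _ []. Qed.
Lemma srB a b : A a -> A b -> A (a - b).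
Proof. by case: sA => _ [_ [h _]]; apply: h. Qed.
Lemma srM a b : A a -> A b -> A (a * b).
Proof. by case: sA => _ [_ [_ h]]; apply: h. Qed.
Lemma srN a : A a -> A (- a).
Proof. by move=> Aa; rewrite -sub0r; apply: srB => //; apply: sr0. Qed.
Lemma srD a b : A a -> A b -> A (a + b).
Proof. by move=> Aa Ab; rewrite -[b]opprK; apply: srB => //; apply: srN. Qed.
Lemma srX a n : A a -> A (a ^+ n).
Proof.
move=> Aa; elim: n => [|n IHn]; first by rewrite expr0; apply: sr1.
by rewrite exprS; apply: srM.
Qed.
Lemma sr_sum (I : Type) (r : seq I) (P : pred I) (F : I -> K) :
  (forall i, P i -> A (F i)) -> A (\sum_(i <- r | P i) F i).
Proof. by move=> AF; apply: big_ind => //; [apply: sr0 | apply: srD]. Qed.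

Lemma unitIn1 : unitIn A 1.
Proof. by split; [apply: sr1 | rewrite oner_neq0 invr1; split=> //; apply: sr1]. Qed.
Lemma unitInM a b : unitIn A a -> unitIn A b -> unitIn A (a * b).
Proof.
move=> [Aa [a0 Aa']] [Ab [b0 Ab']]; split; first exact: srM.
by rewrite mulf_neq0 // invfM; split=> //; apply: srM.
Qed.
Lemma unitInX a n : unitIn A a -> unitIn A (a ^+ n).
Proof.
move=> ua; elim: n => [|n IHn]; first by rewrite expr0; apply: unitIn1.
by rewrite exprS; apply: unitInM.
Qed.
Lemma unitInV a : unitIn A a -> unitIn A a^-1.
Proof. by move=> [Aa [a0 Aa']]; split=> //; rewrite invr_eq0 invrK. Qed.
Lemma ideal_dvd a : A a -> ideal A (dividesIn A a).
Proof.
move=> Aa; split=> [z [h [Ah ->]]|]; first exact: srM.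
split; first by exists 0; split; [apply: sr0 | ring].
split=> [z w [h [Ah ->]] [h' [Ah' ->]]|r z Ar [h [Ah ->]]].
  by exists (h + h'); split; [apply: srD | ring].
by exists (r * h); split; [apply: srM | ring].
Qed.

Lemma dvd_refl a : dividesIn A a a.
Proof. by exists 1; split; [apply: sr1 | rewrite mulr1]. Qed.

End Subring.

Section Ideals.
Variables (K : fieldType) (A : K -> Prop).
Hypothesis sA : subring A.

Section Closure.
Variables (I : K -> Prop).
Hypothesis iI : ideal A I.
Lemma idS z : I z -> A z. Proof. by case: iI => h _; apply: h. Qed.
Lemma id0 : I 0. Proof. by case: iI => _ []. Qed.
Lemma idD a b : I a -> I b -> I (a + b).
Proof. by case: iI => _ [_ [h _]]; apply: h. Qed.
Lemma idMl r a : A r -> I a -> I (r * a).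
Proof. by case: iI => _ [_ [_ h]]; apply: h. Qed.
Lemma idMr r a : A r -> I a -> I (a * r).
Proof. by rewrite mulrC; apply: idMl. Qed.
Lemma idN a : I a -> I (- a).
Proof. by move=> Ia; rewrite -mulN1r; apply: idMl => //; apply: srN => //; apply: sr1. Qed.
Lemma idB a b : I a -> I b -> I (a - b).
Proof. by move=> Ia Ib; apply: idD => //; apply: idN. Qed.
Lemma id_unit u : unitIn A u -> I u -> I 1.
Proof. by move=> [_ [u0 Au]] Iu; rewrite -(mulVf u0); apply: idMl. Qed.
End Closure.

Definition lincomb (s : seq K) (z : K) : Prop :=
  exists r : nat -> K, (forall j, A (r j)) /\ z = \sum_(j < size s) r j * s`_j.

Lemma lincomb_nil z : lincomb [::] z <-> z = 0.
Proof.
split=> [[r [_ ->]]|->]; first by rewrite big_ord0.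
by exists (fun=> 0); split=> [_|]; [apply: sr0 | rewrite big_ord0].
Qed.

Lemma lincomb_cons x s z :
  lincomb (x :: s) z <-> exists r w, A r /\ lincomb s w /\ z = r * x + w.
Proof.
split=> [[r [Ar ->]]|[r [w [Ar [[c [Ac ->]] ->]]]]].
  exists (r 0%N), (\sum_(j < size s) r j.+1 * s`_j); split=> //; split.
    by exists (fun j => r j.+1).
  by rewrite big_ord_recl.
exists (fun j => if j is j'.+1 then c j' else r); split=> [[|j]//|].
by rewrite big_ord_recl.
Qed.

Lemma lincomb_sub I s z : ideal A I -> (forall w, w \in s -> I w) -> lincomb s z -> I z.
Proof.
move=> iI Is [r [Ar ->]]; apply: big_ind => [||j _]; first exact: id0.
  exact: idD.
by apply: idMl => //; apply: Is; apply: mem_nth.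
Qed.

Lemma lincomb_ideal s : (forall w, w \in s -> A w) -> ideal A (lincomb s).
Proof.
elim: s => [|x s IHs] As.
  split=> [z /lincomb_nil ->|]; first exact: sr0.
  split; first exact/lincomb_nil.
  split=> [a b /lincomb_nil -> /lincomb_nil ->|r a _ /lincomb_nil ->]; apply/lincomb_nil; ring.
have Ax : A x by apply: As; rewrite mem_head.
have ih : ideal A (lincomb s) by apply: IHs => w ws; apply: As; rewrite inE ws orbT.
split=> [z /lincomb_cons[r [w [Ar [sw ->]]]]|].
  by apply: (srD sA); [apply: srM | apply: (idS ih)].
split; first by apply/lincomb_cons; exists 0, 0; split; [apply: sr0|split; [apply: id0|ring]].
split=> [a b /lincomb_cons[r [w [Ar [sw ->]]]] /lincomb_cons[r' [w' [Ar' [sw' ->]]]]|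
         c a Ac /lincomb_cons[r [w [Ar [sw ->]]]]]; apply/lincomb_cons.
  exists (r + r'), (w + w'); split; first exact: srD.
  by split; [apply: idD | ring].
exists (c * r), (c * w); split; first exact: srM.
by split; [apply: idMl | ring].
Qed.

Lemma lincomb_mem s z : z \in s -> lincomb s z.
Proof.
elim: s => // x s IHs; rewrite inE => zs; apply/lincomb_cons.
have [zx|nzx] := eqVneq z x.
  exists 1, 0; split; first exact: sr1.
  split; last by rewrite zx; ring.
  exists (fun=> 0); split=> [_|]; first exact: sr0.
  by rewrite big1 // => j _; rewrite mul0r.
exists 0, z; split; first exact: sr0.
by split; [apply: IHs => //; rewrite (negPf nzx) in zs | ring].
Qed.

(** The union is an ideal, and its finitely many generators all lie in one [J N]. *)
Lemma acc (J : nat -> K -> Prop) : noetherian A ->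
  (forall n, ideal A (J n)) -> (forall n z, J n z -> J n.+1 z) ->
  exists N, forall n z, J n z -> J N z.
Proof.
move=> nA iJ JS.
have Jmono n m z : (n <= m)%N -> J n z -> J m z.
  move=> /subnKC <-; elim: (m - n)%N => [|d IHd]; first by rewrite addn0.
  by move=> Jz; rewrite addnS; apply/JS/IHd.
have iU : ideal A (fun z => exists n, J n z).
  split=> [z [n]|]; first exact: (idS (iJ n)).
  split; first by exists 0%N; apply: id0.
  split=> [a b [n Ja] [m Jb]|r a Ar [n Ja]]; last by exists n; apply: idMl.
  exists (maxn n m); apply: idD => //; apply: Jmono; first last.
  - exact: Jb.
  - exact: leq_maxr.
  - exact: Ja.
  - exact: leq_maxl.
have [s sU] := nA _ iU.
have [N JN] : exists N, forall w, w \in s -> J N w.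
  have : forall w, w \in s -> exists n, J n w.
    by move=> w ws; apply/sU/lincomb_mem.
  elim: (s) => [|x t IHt] Ut; first by exists 0%N.
  have [|N JN] := IHt; first by move=> w wt; apply: Ut; rewrite inE wt orbT.
  have [n Jx] := Ut x (mem_head _ _).
  exists (maxn n N) => w; rewrite inE => /orP[/eqP->|wt].
    by apply: Jmono Jx; apply: leq_maxl.
  by apply: Jmono (JN w wt); apply: leq_maxr.
exists N => n z Jz; apply: (@lincomb_sub _ s) => //; apply/sU; by exists n.
Qed.

End Ideals.

(** * Local noetherian rings *)

Section Local.
Variables (K : fieldType) (A : K -> Prop).
Hypothesis lA : local_ring A.
Let sA : subring A := proj1 lA.
Let mA : ideal A (maxid A) := proj2 lA.

Lemma maxid1 : ~ maxid A 1.
Proof. by move=> [_ []]; apply: unitIn1. Qed.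

Lemma unitIn_or_maxid z : A z -> unitIn A z \/ maxid A z.
Proof. by move=> Az; case: (classic (unitIn A z)) => ?; [left | right]. Qed.

Lemma unitIn_1sub m : maxid A m -> unitIn A (1 - m).
Proof.
move=> Mm; case: (@unitIn_or_maxid (1 - m)) => // [|M1].
  by apply: (srB sA); [apply: sr1 | apply: idS Mm].
by case: maxid1; rewrite -[1](subrK m); apply: (idD mA).
Qed.

Lemma prime_ideal0 : prime_ideal A (fun z => z = 0).
Proof.
split; last first.
  split=> [/eqP|a b _ _ /eqP]; first by rewrite oner_eq0.
  by rewrite mulf_eq0 => /orP[]/eqP; [left|right].
split=> [z ->|]; first exact: sr0.
by split=> //; split=> [a b -> ->|r a _ ->]; rewrite ?addr0 ?mulr0.
Qed.

Lemma prime_ideal_maxid : prime_ideal A (maxid A).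
Proof.
split=> //; split=> [|a b Aa Ab [_ nab]]; first exact: maxid1.
apply: NNPP => /not_or_and[na nb]; apply: nab; apply: unitInM => //.
  by case: (unitIn_or_maxid Aa) => // /na.
by case: (unitIn_or_maxid Ab) => // /nb.
Qed.

Lemma prime_sub_maxid P z : prime_ideal A P -> P z -> maxid A z.
Proof.
move=> [iP [P1 _]] Pz; split=> [|uz]; first exact: idS Pz.
exact/P1/(id_unit iP uz Pz).
Qed.

Lemma prime_power P z n : prime_ideal A P -> A z -> P (z ^+ n) -> P z.
Proof.
move=> [_ [P1 Pp]] Az; elim: n => [|n IHn]; first by rewrite expr0.
by rewrite exprS => /Pp[]//; apply: srX.
Qed.

Definition adj (J : K -> Prop) (a z : K) : Prop :=
  exists j r, J j /\ A r /\ z = j + a * r.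

Lemma ideal_adj J a : ideal A J -> A a -> ideal A (adj J a).
Proof.
move=> iJ Aa; split=> [z [j [r [Jj [Ar ->]]]]|].
  by apply: (srD sA); [apply: idS Jj | apply: srM].
split; first by exists 0, 0; split; [exact: (id0 iJ)|split; [apply: sr0|ring]].
split=> [z w [j [r [Jj [Ar ->]]]] [j' [r' [Jj' [Ar' ->]]]]|
         c z Ac [j [r [Jj [Ar ->]]]]].
  exists (j + j'), (r + r'); split; first exact: (idD iJ).
  by split; [apply: srD | ring].
exists (c * j), (c * r); split; first exact: (idMl iJ).
by split; [apply: srM | ring].
Qed.

Lemma adj_id J a j : J j -> adj J a j.
Proof. by exists j, 0; split=> //; split; [apply: sr0 | ring]. Qed.

Lemma adj_gen J a : ideal A J -> adj J a a.
Proof.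
by move=> iJ; exists 0, 1; split; [exact: (id0 iJ)|split; [apply: sr1|ring]].
Qed.

Lemma nakayama I J u s : ideal A J -> maxid A u ->
  (forall z, I z <-> exists j w, J j /\ lincomb A s w /\ z = j + w) ->
  (forall z, I z -> exists j w, J j /\ I w /\ z = j + u * w) ->
  forall z, I z -> J z.
Proof.
move=> iJ mu; elim: s I => [|x s IHs] I Is IJ.
  by move=> z /Is[j [w [Jj [/lincomb_nil ->]]]] // ->; rewrite addr0.
have Au : A u by apply: idS mA _ _.
have Ix : I x.
  apply/Is; exists 0, x; split; first exact: (id0 iJ).
  by split; [apply: lincomb_mem => //; rewrite mem_head | rewrite add0r].
have [j [w [Jj [/Is[j' [_ [Jj' [/lincomb_cons[r [w' [Ar [sw' ->]]]] ->]]]] xE]]]] :=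
  IJ _ Ix.
have [Ae' [e0 Ae]] : unitIn A (1 - u * r) by apply: unitIn_1sub; apply: (idMr mA).
set e := (1 - u * r)^-1 in Ae.
have {}xE : x = e * (j + u * j') + e * u * w'.
  apply: (mulfI e0); rewrite mulrDr !mulrA /e divff // !mul1r.
  by rewrite mulrBl mul1r {1}xE; ring.
have Jx : J (e * (j + u * j')) by apply: (idMl iJ) => //; apply: (idD iJ) => //; apply: (idMl iJ).
apply: IHs => // z; split=> [/Is[j1 [_ [Jj1 [/lincomb_cons[r1 [w1 [Ar1 [sw1 ->]]]] ->]]]]|].
  exists (j1 + r1 * (e * (j + u * j'))), (r1 * e * u * w' + w1).
  split; first by apply: (idD iJ) => //; apply: (idMl iJ).
  split; last by rewrite {1}xE; ring.
  case: sw' sw1 => c [Ac ->] [d [Ad ->]]; exists (fun i => r1 * e * u * c i + d i).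
  split=> [i|]; first by apply: srD => //; repeat apply: srM => //.
  by rewrite mulr_sumr -big_split; apply: eq_bigr => i _ /=; ring.
move=> [j1 [w1 [Jj1 [sw1 ->]]]]; apply/Is; exists j1, w1; split=> //; split=> //.
by apply/lincomb_cons; exists 0, w1; split; [apply: sr0 | split=> //; ring].
Qed.

Hypothesis nA : noetherian A.

Lemma nakayama_ideal I J u : ideal A J -> maxid A u -> ideal A I ->
  (forall z, J z -> I z) ->
  (forall z, I z -> exists j w, J j /\ I w /\ z = j + u * w) ->
  forall z, I z -> J z.
Proof.
move=> iJ mu iI JI IJ; have [s sI] := nA iI.
have sI' w : lincomb A s w <-> I w by apply: iff_sym; apply: sI.
apply: (nakayama (s := s) iJ mu) => // z; split=> [Iz|[j [w [Jj [/sI' Iw ->]]]]].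
  exists 0, z; split; first exact: (id0 iJ).
  by split; [apply/sI' | ring].
by apply: (idD iI) => //; apply: JI.
Qed.

(** The Artin-Rees lemma is avoided: the colon ideals [C n] of [J] by [y ^+ n] stabilise at some
    [N], and this forces the intersection [W] of the [J + y^n A] to satisfy [W = J + y W], whence
    [W = J] by Nakayama. *)
Lemma krull_intersection J y w : ideal A J -> maxid A y ->
  (forall n, adj J (y ^+ n) w) -> J w.
Proof.
move=> iJ my; have Ay : A y by case: my.
pose C n z := A z /\ J (y ^+ n * z).
have iC n : ideal A (C n).
  split=> [z []//|]; split; first by split; [apply: sr0 | rewrite mulr0; exact: id0 iJ].
  split=> [a b [Aa Ja] [Ab Jb]|r a Ar [Aa Ja]].
    by split; [apply: srD | rewrite mulrDr; apply: (idD iJ)].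
  by split; [apply: srM | rewrite mulrCA; apply: (idMl iJ)].
have [|N CN] := acc sA nA iC.
  by move=> n z [Az Jz]; split=> //; rewrite exprS -mulrA; apply: (idMl iJ).
have iW : ideal A (fun z => forall n, adj J (y ^+ n) z).
  have ia n := ideal_adj iJ (srX sA n Ay).
  split=> [z /(_ 0%N)|]; first exact: idS.
  split=> [n|]; first exact: (id0 (ia n)).
  by split=> [a b Wa Wb n|r a Ar Wa n]; [apply: (idD (ia n)) | apply: (idMl (ia n))].
move=> Ww; apply: (nakayama_ideal iJ my iW _ _ Ww) => [z Jz n|z Wz].
  exact: adj_id.
have [j [r [Jj [Ar zE]]]] := Wz N.+1.
exists j, (y ^+ N * r); split=> //; split; last by rewrite zE exprS mulrA.
move=> m; have [j' [r' [Jj' [Ar' zE']]]] := Wz (m + N.+1)%N.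
have [_ JN] : C N (r - y ^+ m * r').
  apply: (CN N.+1); split; first by apply: srB => //; apply: srM => //; apply: srX.
  rewrite (_ : _ * _ = j' - j); first exact: (idB sA iJ).
  rewrite -[j'](addrK (y ^+ (m + N.+1) * r')) -zE' zE !exprD; ring.
exists (y ^+ N * (r - y ^+ m * r')), (y ^+ N * r'); split=> //; split.
  by apply: srM => //; apply: srX.
ring.
Qed.

End Local.

(** * Krull's principal ideal theorem when two elements generate the maximal ideal *)

Section Dim2.
Variables (K : fieldType) (A : K -> Prop) (u v : K).
Hypothesis lA : local_ring A.
Hypothesis nA : noetherian A.
Hypothesis mE : forall z, maxid A z <-> exists r s, A r /\ A s /\ z = r * u + s * v.
Let sA : subring A := proj1 lA.
Let mA : ideal A (maxid A) := proj2 lA.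

Lemma maxid_u : maxid A u.
Proof. by apply/mE; exists 1, 0; split; [apply: sr1|split; [apply: sr0|ring]]. Qed.
Lemma maxid_v : maxid A v.
Proof. by apply/mE; exists 0, 1; split; [apply: sr0|split; [apply: sr1|ring]]. Qed.
Let Au : A u := proj1 maxid_u.
Let Av : A v := proj1 maxid_v.

(** Modulo [u] the maximal ideal is generated by [v], so [v] can be split off until a unit appears
    or the exponent reaches [M]. *)
Lemma uv_expand M z : A z ->
  (exists c r, A c /\ A r /\ z = u * c + v ^+ M * r) \/
  (exists i c e, (i < M)%N /\ A c /\ unitIn A e /\ z = u * c + v ^+ i * e).
Proof.
move=> Az; elim: M => [|M IHM].
  by left; exists 0, z; split; [apply: sr0 | split=> //; rewrite expr0; ring].
case: IHM => [[c [r [Ac [Ar zE]]]]|[i [c [e [iM H]]]]]; last first.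
  by right; exists i, c, e; rewrite ltnS ltnW.
case: (unitIn_or_maxid Ar) => [ur|/mE[a [b [Aa [Ab rE]]]]].
  by right; exists M, c, r.
left; exists (c + v ^+ M * a), b; split; last by split=> //; rewrite zE rE exprS; ring.
by apply: (srD sA) => //; apply: srM => //; apply: srX.
Qed.

(** By Krull's intersection theorem [z] is not in [J + v^M A] for some [M], so modulo [u] it is a
    unit times a power of [v] below [M]. The exponent [M] thus serves all [I] at once. *)
Lemma uv_power J z : ideal A J -> J u -> A z -> ~ J z ->
  exists M, forall I, ideal A I -> (forall w, J w -> I w) -> I z -> I (v ^+ M).
Proof.
move=> iJ Ju Az nz.
have [M nM] : exists M, ~ adj A J (v ^+ M) z.
  apply: not_all_ex_not => h; apply: nz.
  exact: (krull_intersection lA nA iJ maxid_v h).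
exists M => I iI JI Iz; have Iu := JI _ Ju.
case: (uv_expand M Az) => [[c [r [Ac [Ar zE]]]]|[i [c [e [iM [Ac [[Ae [e0 Ae']] zE]]]]]]].
  by case: nM; exists (u * c), r; split=> //; apply: (idMr iJ).
rewrite -(subnK (ltnW iM)) exprD; apply: (idMl iI); first exact: srX.
rewrite -[v ^+ i](mulfK e0) mulrC; apply: (idMl iI) => //.
rewrite (_ : _ * e = z - u * c); last by rewrite zE; ring.
by apply: (idB sA iI) => //; apply: (idMr iI).
Qed.

(** [A / (u, v^M)] is Artinian. If [v ^+ M] is missing from some [L n] whose members all contain
    [v ^+ M.+1], then [L n] is already the smallest ideal allowed, generated by [u] and
    [v ^+ M.+1]. *)
Lemma dcc M (L : nat -> K -> Prop) : (forall n, ideal A (L n)) ->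
  (forall n, L n u) -> (forall n, L n (v ^+ M)) ->
  (forall n z, L n.+1 z -> L n z) -> exists n, forall z, L n z -> L n.+1 z.
Proof.
elim: M L => [|M IHM] L iL Lu LM Ldec.
  exists 0%N => z Lz; rewrite -[z]mulr1; apply: (idMl (iL _)); first exact: idS Lz.
  by rewrite -(expr0 v).
case: (classic (forall n, L n (v ^+ M))) => [h|/not_all_ex_not[n nM]].
  exact: IHM iL Lu h Ldec.
exists n => z Lz; case: (uv_expand M.+1 (idS (iL n) Lz)).
  move=> [c [r [Ac [Ar ->]]]].
  by apply: (idD (iL _)); apply: (idMr (iL _)).
move=> [i [c [e [iM [Ac [[Ae [e0 Ae']] zE]]]]]]; case: nM.
rewrite -(subnK (iM : (i <= M)%N)) exprD; apply: (idMl (iL _)); first exact: srX.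
rewrite -[v ^+ i](mulfK e0) mulrC; apply: (idMl (iL _)) => //.
rewrite (_ : _ * e = z - u * c); last by rewrite zE; ring.
by apply: (idB sA (iL _)) => //; apply: (idMr (iL _)).
Qed.

(* Krull's principal ideal theorem in A / P1, for the parameter u: the saturations J n of the
   powers of z with respect to u form a decreasing chain which must stabilise modulo u. *)
Lemma pit M P1 P2 : prime_ideal A P1 -> prime_ideal A P2 -> sincl P1 P2 ->
  adj A P1 u (v ^+ M) -> forall z, maxid A z -> P2 z.
Proof.
move=> pP1 pP2 [P12 [z [P2z nP1z]]] vM.
have [[iP1 [nP11 P1p]] [iP2 [nP21 P2p]]] := (pP1, pP2).
have Az : A z := idS iP2 P2z.
have v_of_u : P2 u -> P2 v.
  move=> P2u; apply: (prime_power lA (n := M) pP2 Av).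
  have [j [r [P1j [Ar ->]]]] := vM.
  by apply: (idD iP2); [apply: P12 | apply: (idMr iP2)].
suff P2u : P2 u.
  move=> w /mE[r [s [Ar [As ->]]]]; apply: (idD iP2); apply: (idMl iP2) => //.
  exact: v_of_u.
apply: NNPP => nP2u.
pose J n w := A w /\ exists m, adj A P1 (z ^+ n) (u ^+ m * w).
have iadj n : ideal A (adj A P1 (z ^+ n)) by apply: ideal_adj => //; apply: srX.
have iJ n : ideal A (J n).
  split=> [w []//|]; split.
    by split; [apply: sr0 | exists 0%N; rewrite mulr0; apply: id0].
  split=> [a b [Aa [m Ja]] [Ab [m' Jb]]|r a Ar [Aa [m Ja]]].
    split; [exact: srD | exists (m + m')%N].
    rewrite (_ : _ * _ = u ^+ m' * (u ^+ m * a) + u ^+ m * (u ^+ m' * b)); last first.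
      by rewrite exprD; ring.
    by apply: (idD (iadj n)); apply: (idMl (iadj n)) => //; apply: srX.
  split; [exact: srM | exists m].
  by rewrite mulrCA; apply: (idMl (iadj n)).
have Jdec n w : J n.+1 w -> J n w.
  move=> [Aw [m [j [r [P1j [Ar E]]]]]]; split=> //; exists m.
  exists j, (z * r); split=> //; split; first exact: srM.
  by rewrite E exprSr mulrA.
have P1J n w : P1 w -> J n w.
  move=> P1w; split; first exact: idS P1w.
  by exists 0%N; rewrite expr0 mul1r; apply: adj_id.
pose L n := adj A (J n) u.
have [n Ln] : exists n, forall w, L n w -> L n.+1 w.
  apply: (@dcc M) => n.
  - exact: ideal_adj.
  - exact: adj_gen.
  - have [j [r [P1j [Ar ->]]]] := vM; exists j, r; split=> //; exact: P1J.
  - by move=> w [j [r [/Jdec Jj [Ar ->]]]]; exists j, r.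
(* Write [w = j + u * r] with [j] in [J n.+1]. Then [u * r] is in [J n], and saturation puts [r]
   itself there: [J n = J n.+1 + u * J n], and Nakayama applies. *)
have JJ : forall w, J n w -> J n.+1 w.
  apply: (nakayama_ideal lA nA (iJ _) maxid_u (iJ n) (Jdec n)) => w Jw.
  have [j [r [Jj [Ar wE]]]] := Ln w (adj_id lA u Jw).
  exists j, r; split=> //; split=> //; split=> //.
  have [_ [m H]] : J n (u * r).
    by rewrite (_ : _ * _ = w - j); [apply: (idB sA (iJ n)) => //; apply: Jdec
                                    | rewrite wE; ring].
  by exists m.+1; rewrite exprSr -mulrA.
(* Now [z ^+ n * (u ^+ m - z * c)] lies in [P1] and [z] does not, so [u ^+ m] is in [P1 + zA], hence
   in [P2]. *)
have [_ [m [j [c [P1j [Ac E]]]]]] : J n.+1 (z ^+ n).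
  apply: JJ; split; first exact: srX.
  by exists 0%N; rewrite expr0 mul1r; apply: adj_gen.
apply: nP2u; apply: (prime_power lA (n := m) pP2 Au).
have /P1p : P1 (z ^+ n * (u ^+ m - z * c)).
  by rewrite (_ : _ * _ = j) // mulrBr [_ * u ^+ m]mulrC E exprSr; ring.
case=> [||/(prime_power lA pP1 Az)/nP1z//|/P12 h]; first exact: srX.
  by apply: (srB sA); [apply: srX | apply: srM].
by rewrite -[_ ^+ _](subrK (z * c)); apply: (idD iP2) => //; apply: (idMr iP2).
Qed.

End Dim2.

(** * Regular parameters in dimension two *)

Section RegParams.
Variables (K : fieldType) (A : K -> Prop).

Lemma reg_params_sym u v : reg_params A u v -> reg_params A v u.
Proof.
move=> [lA [nA [dA [mu [mv mE]]]]]; do 5!(split; first by []).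
move=> z; split=> [/mE[r [s [Ar [As ->]]]]|[r [s [Ar [As ->]]]]].
  by exists s, r; rewrite addrC.
by apply/mE; exists s, r; rewrite addrC.
Qed.

Lemma reg_params_unit u v g : reg_params A u v -> unitIn A g -> reg_params A u (v * g).
Proof.
move=> [lA [nA [dA [mu [mv mE]]]]] [Ag [g0 Ag']]; have [sA mA] := lA.
do 4!(split; first by []); split; first exact: (idMr mA).
move=> z; split=> [/mE[r [s [Ar [As ->]]]]|[r [s [Ar [As ->]]]]].
  exists r, (s * g^-1); split=> //; split; first exact: srM.
  by rewrite mulrA; congr (_ + _); rewrite mulrAC mulfVK.
by apply/mE; exists r, (s * g); split=> //; split; [apply: srM | ring].
Qed.

(** Otherwise [pit] over the zero ideal would make every nonzero prime maximal, against the middle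
    term of a chain of three primes. *)
Lemma reg_params_power u v M : reg_params A u v -> ~ dividesIn A u (v ^+ M).
Proof.
move=> [lA [nA [[[P0 [P1 [P2 [p0 [p1 [p2 [[_ [z [P1z nP0z]]] [P12 [w [P2w nP1w]]]]]]]]]] _]
             [mu [mv mE]]]]] [r [Ar vE]].
apply/nP1w/(pit lA nA mE (M := M) (prime_ideal0 lA) p1 _ _ (prime_sub_maxid p2 P2w)).
  split=> [_ ->|]; first by case: p1 => i1 _; apply: (id0 i1).
  by exists z; split=> // z0; apply: nP0z; rewrite z0; case: p0 => i0 _; apply: (id0 i0).
by exists 0, r; rewrite add0r.
Qed.

(** If [u] divides [a * b] but neither factor, the colon of [(u)] by [b] contains [a], hence some
    [v ^+ M]; then the colon by [v ^+ M] contains [b], hence some [v ^+ N], and [u] divides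
    [v ^+ (M + N)]. *)
Lemma reg_params_prime u v : reg_params A u v -> prime_ideal A (dividesIn A u).
Proof.
move=> huv; have nv M := reg_params_power (M := M) huv.
move: huv => [lA [nA [_ [[Au _] [[Av _] mE]]]]]; have sA := proj1 lA.
have iu := ideal_dvd (proj1 lA) Au; have uu := dvd_refl (proj1 lA) u.
split=> //; split=> [|a b Aa Ab uab]; first by have := nv 0%N; rewrite expr0.
apply: NNPP => /not_or_and[na nb].
have [M hM] := uv_power lA nA mE iu uu Aa na.
have [N hN] := uv_power lA nA mE iu uu Ab nb.
have icolon c : A c -> ideal A (fun z => A z /\ dividesIn A u (c * z)).
  move=> Ac; split=> [z []//|]; split.
    by split; [apply: sr0 | rewrite mulr0; apply: (id0 iu)].
  split=> [x y [Ax ux] [Ay uy]|r x Ar [Ax ux]].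
    by split; [apply: srD | rewrite mulrDr; apply: (idD iu)].
  by split; [apply: srM | rewrite mulrCA; apply: (idMl iu)].
have colonP c w : A c -> dividesIn A u w -> A w /\ dividesIn A u (c * w).
  by move=> Ac uw; split; [apply: idS uw | apply: (idMl iu)].
have [_ h1] := hM _ (icolon b Ab) (colonP b ^~ Ab) (conj Aa (eq_ind _ _ uab _ (mulrC a b))).
have Av' := srX sA M Av.
rewrite mulrC in h1.
have [_] := hN _ (icolon _ Av') (colonP _ ^~ Av') (conj Ab h1).
by rewrite -exprD; apply: nv.
Qed.

Lemma reg_params_ndvd u v : reg_params A u v -> ~ dividesIn A u v.
Proof. by move/(reg_params_power (M := 1)); rewrite expr1. Qed.

Lemma reg_params_neq0 u v : reg_params A u v -> u != 0.
Proof.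
move=> huv; have [lA _] := huv; apply/eqP => u0.
apply: (reg_params_ndvd (reg_params_sym huv)); exists 0.
by rewrite u0 mulr0; split=> //; apply: sr0 (proj1 lA).
Qed.

(** The chain of zero, [(u)] and the maximal ideal bounds the dimension below. For the upper bound,
    [P2] in a chain of four is forced to be maximal: if [u] is in [P1] then [P2] contains a power of
    [v]; if not, [P1 + uA] contains one and [pit] applies. *)
Lemma reg_params_intro u v : local_ring A -> noetherian A ->
  (forall z, maxid A z <-> exists r s, A r /\ A s /\ z = r * u + s * v) ->
  prime_ideal A (dividesIn A u) -> u != 0 -> ~ dividesIn A u v -> reg_params A u v.
Proof.
move=> lA nA mE pu u0 nuv; have [sA mA] := lA.
have mu := maxid_u lA mE; have mv := maxid_v lA mE; have [[Au _] [Av _]] := (mu, mv).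
split=> //; split=> //; split; last by [].
split.
  exists (fun z => z = 0), (dividesIn A u), (maxid A).
  do 3!(split; first by [apply: prime_ideal0 | apply: prime_ideal_maxid |]).
  split; split=> [z|]; first by move=> ->; case: pu => iu _; apply: (id0 iu).
  - by exists u; split; [apply: dvd_refl sA _ | apply/eqP].
  - by move=> [r [Ar ->]]; apply: (idMr mA).
  - by exists v.
move=> [P0 [P1 [P2 [P3 [p0 [p1 [p2 [p3 [s01 [s12 s23]]]]]]]]]].
have [_ [w [P3w nP2w]]] := s23; have [P12 [z [P2z nP1z]]] := s12.
have [_ [g [P1g nP0g]]] := s01; have [iP1 [_ P1p]] := p1; have [iP2 _] := p2.
have mw := prime_sub_maxid p3 P3w.
have iu := ideal_dvd sA Au; have uu := dvd_refl sA u.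
have g0 : g <> 0 by move=> g0; apply: nP0g; rewrite g0; case: p0 => i0 _; apply: (id0 i0).
case: (classic (P1 u)) => [P1u|nP1u].
  have Iu I : ideal A I -> I u -> forall t, dividesIn A u t -> I t.
    by move=> iI hu t [r [Ar ->]]; apply: (idMr iI).
  have nuz : ~ dividesIn A u z by move=> /(Iu P1 iP1 P1u).
  have [M hM] := uv_power lA nA mE iu uu (idS iP2 P2z) nuz.
  have P2v := prime_power lA p2 Av (hM _ iP2 (Iu _ iP2 (P12 _ P1u)) P2z).
  apply: nP2w; move/mE: mw => [r [s [Ar [As ->]]]].
  by apply: (idD iP2); apply: (idMl iP2) => //; apply: P12.
(* Divide [g] by [u] as often as possible: Krull's intersection theorem bounds the number of
   divisions, and the quotients stay in the prime [P1] because [u] is outside it. *)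
have [h [P1h nuh]] : exists h, P1 h /\ ~ dividesIn A u h.
  have [i0 _] := prime_ideal0 lA.
  have [n hn] : exists n, ~ adj A (fun t => t = 0) (u ^+ n) g.
    by apply: not_all_ex_not => h; apply: g0; apply: (krull_intersection lA nA i0 mu h).
  elim: n g P1g hn {nP0g g0} => [|n IHn] g P1g hn.
    case: hn; exists 0, g; split=> //; split; first exact: idS P1g.
    by rewrite expr0; ring.
  case: (classic (dividesIn A u g)) => [[h [Ah gE]]|]; last by exists g.
  apply: (IHn h) => [|[j [r [-> [Ar hE]]]]].
    by move: P1g; rewrite gE => /P1p[].
  by apply: hn; exists 0, r; split=> //; split=> //; rewrite gE hE exprS; ring.
have iadj := ideal_adj lA iP1 Au.
have [M hM] := uv_power lA nA mE iu uu (idS iP1 P1h) nuh.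
apply/nP2w/(pit lA nA mE p1 p2 s12 _ mw)/(hM _ iadj); last exact: adj_id.
by move=> t [r [Ar ->]]; exists 0, r; split; [apply: (id0 iP1) | rewrite add0r].
Qed.

End RegParams.

(** * Adjunction, localization and quasi-regularity *)

Lemma lincomb_subset (K : fieldType) (A : K -> Prop) s s' z :
  subring A -> {subset s <= s'} -> (forall w, w \in s' -> A w) ->
  lincomb A s z -> lincomb A s' z.
Proof.
move=> sA ss' As'; apply: lincomb_sub; first exact: lincomb_ideal.
by move=> w /ss'; apply: lincomb_mem.
Qed.

Section PolyIn.
Variables (K : fieldType) (A : K -> Prop).
Hypothesis sA : subring A.

Definition polyIn (P : {poly K}) : Prop := forall j, A P`_j.

Lemma polyInD P Q : polyIn P -> polyIn Q -> polyIn (P + Q).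
Proof. by move=> hP hQ j; rewrite coefD; apply: srD. Qed.
Lemma polyInB P Q : polyIn P -> polyIn Q -> polyIn (P - Q).
Proof. by move=> hP hQ j; rewrite coefB; apply: srB. Qed.
Lemma polyInM P Q : polyIn P -> polyIn Q -> polyIn (P * Q).
Proof. by move=> hP hQ j; rewrite coefM; apply: sr_sum => // i _; apply: srM. Qed.
Lemma polyInZ c P : A c -> polyIn P -> polyIn (c *: P).
Proof. by move=> Ac hP j; rewrite coefZ; apply: srM. Qed.
Lemma polyInC c : A c -> polyIn c%:P.
Proof. by move=> Ac j; rewrite coefC; case: eqP => _ //; apply: sr0. Qed.
Lemma polyInX : polyIn 'X.
Proof. by move=> j; rewrite coefX; case: eqP => _; [apply: sr1 | apply: sr0]. Qed.
Lemma polyInXn n : polyIn 'X^n.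
Proof. by move=> j; rewrite coefXn; case: eqP => _; [apply: sr1 | apply: sr0]. Qed.
Lemma polyIn_take d P : polyIn P -> polyIn (take_poly d P).
Proof. by move=> hP j; rewrite coef_take_poly; case: ifP => _ //; apply: sr0. Qed.

Lemma adjoinP t z : adjoin A t z <-> exists P, polyIn P /\ z = P.[t].
Proof.
split=> [[c [d [Ac ->]]]|[P [hP ->]]].
  exists (\poly_(j < d) c j); split; last by rewrite horner_poly.
  by move=> j; rewrite coef_poly; case: ifP => _ //; apply: sr0.
by exists (fun j => P`_j), (size P); rewrite horner_coef.
Qed.

Lemma adjoin_id t z : A z -> adjoin A t z.
Proof. by move=> Az; apply/adjoinP; exists z%:P; rewrite hornerC; split=> //; apply: polyInC. Qed.

Lemma adjoin_gen t : adjoin A t t.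
Proof. by apply/adjoinP; exists 'X; rewrite hornerX; split=> //; apply: polyInX. Qed.

Lemma subring_adjoin t : subring (adjoin A t).
Proof.
split; first by apply: adjoin_id; apply: sr0.
split; first by apply: adjoin_id; apply: sr1.
split=> a b /adjoinP[P [hP ->]] /adjoinP[Q [hQ ->]]; apply/adjoinP.
  by exists (P - Q); rewrite hornerD hornerN; split=> //; apply: polyInB.
by exists (P * Q); rewrite hornerM; split=> //; apply: polyInM.
Qed.

(** Hilbert's argument on polynomial representatives, since elements of [A[t]] have no degree of
    their own. [L n] collects the coefficients at ['X^n], possibly zero, of those [P] of degree at
    most [n] with [P.[t]] in [I]. *)
Lemma adjoin_noetherian t : noetherian A -> noetherian (adjoin A t).
Proof.
move=> nA I iI; have sC := subring_adjoin t.
pose lift n c Q := polyIn Q /\ (size Q <= n.+1)%N /\ Q`_n = c.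
pose L n c := exists P, lift n c P /\ I P.[t].
have iL n : ideal A (L n).
  split=> [c [P [[hP [_ <-]] _]]|]; first exact: hP.
  split.
    exists 0; split; last by rewrite horner0; apply: (id0 iI).
    by split=> [j|]; rewrite ?size_poly0 ?coef0 //; apply: sr0.
  split=> [c d [P [[hP [sP <-]] IP]] [Q [[hQ [sQ <-]] IQ]]|r c Ar [P [[hP [sP <-]] IP]]].
    exists (P + Q); rewrite hornerD; split; last exact: (idD iI).
    split; first exact: polyInD.
    by rewrite coefD (leq_trans (size_polyD _ _)) ?geq_max ?sP.
  exists (r *: P); rewrite hornerZ; split; last by apply: (idMl iI) => //; apply: adjoin_id.
  by split; [apply: polyInZ | rewrite coefZ (leq_trans (size_scale_leq _ _))].
have Lmono n c : L n c -> L n.+1 c.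
  move=> [P [[hP [sP <-]] IP]]; exists (P * 'X); rewrite hornerMX; split.
    split; first by apply: polyInM => //; apply: polyInX.
    by rewrite coefMX; have [->|P0] := eqVneq P 0; rewrite ?mul0r ?size_poly0 ?size_mulX.
  by apply: (idMr iI) => //; apply: adjoin_gen.
have [N LN] := acc sA nA iL Lmono.
have gens n : exists G, (forall g, g \in G -> I g) /\
    forall c, L n c -> exists Q, lift n c Q /\ lincomb (adjoin A t) G Q.[t].
  have [s sL] := nA _ (iL n).
  have {sL} [sL Ls] : (forall x, x \in s -> L n x) /\ (forall c, L n c -> lincomb A s c).
    by split=> [x /(lincomb_mem sA)/sL|c /sL].
  suff [G [GI hG]] : exists G, (forall g, g \in G -> I g) /\ forall c, lincomb A s c ->
      exists Q, lift n c Q /\ lincomb (adjoin A t) G Q.[t].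
    by exists G; split=> // c /Ls/hG.
  elim: s sL {Ls} => [|x s IHs] sL.
    exists [::]; split=> // c /(lincomb_nil sA) ->; exists 0; split.
      by split=> [j|]; rewrite ?size_poly0 ?coef0 //; apply: sr0.
    by rewrite horner0; apply/(lincomb_nil sC).
  have [|G [GI hG]] := IHs; first by move=> y ys; apply: sL; rewrite inE ys orbT.
  have [P [[hP [sP Px]] IP]] := sL _ (mem_head _ _).
  exists (P.[t] :: G); split=> [g|c /lincomb_cons[r [w [Ar [/hG[Q [[hQ [sQ <-]] GQ]] ->]]]]].
    by rewrite inE => /orP[/eqP->|/GI].
  exists (r *: P + Q); split.
    split; first by apply: polyInD => //; apply: polyInZ.
    rewrite coefD coefZ Px (leq_trans (size_polyD _ _)) // geq_max sQ andbT.
    by rewrite (leq_trans (size_scale_leq _ _)).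
  apply/lincomb_cons; exists r, Q.[t]; rewrite hornerD hornerZ.
  by split; first exact: adjoin_id.
have [G [GI hG]] : exists G, (forall g, g \in G -> I g) /\ forall n c, (n <= N)%N -> L n c ->
    exists Q, lift n c Q /\ lincomb (adjoin A t) G Q.[t].
  elim: (N) => [|M [G [GI hG]]].
    by have [G [GI hG]] := gens 0%N; exists G; split=> // n c; rewrite leqn0 => /eqP ->; apply: hG.
  have [G' [GI' hG']] := gens M.+1; exists (G ++ G'); split=> [g|n c].
    by rewrite mem_cat => /orP[/GI|/GI'].
  have CG w : w \in G ++ G' -> adjoin A t w.
    by rewrite mem_cat => /orP[/GI|/GI']; apply: idS.
  rewrite leq_eqVlt ltnS => /orP[/eqP->{n} /hG'|nM /(hG n c nM)] [Q [lQ GQ]];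
    exists Q; split=> //; apply: (lincomb_subset sC _ CG GQ) => // g; rewrite mem_cat => -> //.
  by rewrite orbT.
(* Above the stable index [N], a lift of degree [N] is multiplied by ['X^(n - N)]. *)
have {}hG n c : L n c -> exists Q, lift n c Q /\ lincomb (adjoin A t) G Q.[t].
  move=> Lc; have [/hG|/ltnW nN] := leqP n N; first exact.
  have [Q [[hQ [sQ Qc]] GQ]] := hG N c (leqnn _) (LN _ _ Lc).
  exists (Q * 'X^(n - N)); split.
    split; first by apply: polyInM => //; apply: polyInXn.
    rewrite coefMXn ltnNge leq_subr /= subKn // Qc; split=> //.
    rewrite (leq_trans (size_polyMleq _ _)) // size_polyXn addnS /=.
    by rewrite (leq_trans (leq_add sQ (leqnn _))) // addSn subnKC.
  rewrite hornerM hornerXn mulrC.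
  have iG := lincomb_ideal sC (fun w wG => idS iI (GI w wG)).
  by apply: (idMl iG) => //; apply: srX => //; apply: adjoin_gen.
have iG := lincomb_ideal sC (fun w wG => idS iI (GI w wG)).
exists G => z; rewrite -/(lincomb (adjoin A t) G z); split; last exact: lincomb_sub.
move=> Iz; have /adjoinP[P [hP zE]] := idS iI Iz; rewrite zE in Iz *.
elim: {z zE}(size P) {-2}P (leqnn (size P)) hP Iz => [|d IHd] {}P sP hP IP.
  by move: sP; rewrite leqn0 size_poly_eq0 => /eqP ->; rewrite horner0; apply: (id0 iG).
have [|Q [[hQ [sQ QP]] GQ]] := hG d P`_d; first by exists P.
rewrite -[P](subrK Q) hornerD; apply: (idD iG) => //; apply: IHd; last 1 first.
- by rewrite hornerD hornerN; apply: (idB sC iI) => //; apply: lincomb_sub GQ.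
- apply/leq_sizeP => j; rewrite leq_eqVlt => /orP[/eqP <-|dj]; first by rewrite coefB QP subrr.
  by rewrite coefB !nth_default ?subrr // (leq_trans _ dj).
- exact: polyInB.
Qed.

End PolyIn.

(** Generators of the contraction of [I] to [C] generate [I], as the denominators are invertible in
    [B]. *)
Lemma localization_noetherian (K : fieldType) (C U B : K -> Prop) : subring C -> subring B ->
  (forall z, C z -> B z) -> (forall s, U s -> C s /\ s != 0 /\ B s^-1) ->
  (forall z, B z -> exists r s, C r /\ U s /\ z = r / s) ->
  noetherian C -> noetherian B.
Proof.
move=> sC sB CB hU hB nC I iI.
have [|s sI] := nC (fun z => C z /\ I z).
  split=> [z []//|]; split; first by split; [apply: sr0 | apply: (id0 iI)].
  split=> [a b [Ca Ia] [Cb Ib]|r a Cr [Ca Ia]].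
    by split; [apply: srD | apply: (idD iI)].
  by split; [apply: srM | apply: (idMl iI) => //; apply: CB].
exists s => z; rewrite -/(lincomb B s z); split=> [Iz|].
  have [r [d [Cr [/hU[Cd [d0 Bd]] zE]]]] := hB z (idS iI Iz).
  have [|c [Cc rE]] := (sI r).1.
    split=> //; rewrite (_ : r = d * z); first by apply: (idMl iI) => //; apply: CB.
    by rewrite zE mulrC mulfVK.
  exists (fun j => c j / d); split=> [j|]; first by apply: srM => //; apply: CB.
  by rewrite zE rE mulr_suml; apply: eq_bigr => j _; rewrite mulrAC.
by apply: lincomb_sub => // w ws; case: ((sI w).2 (lincomb_mem sC ws)).
Qed.

(** Clearing denominators shows that [a] divides [c * b ^+ d] for the top coefficient [c]; as [a] is
    prime and divides no power of [b], [c = a * s]. The top term then equals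
    [s * b * (b / a) ^+ (d - 1)] and is absorbed one degree lower, changing that coefficient by an
    element of the maximal ideal. *)
Lemma quasi_regular (K : fieldType) (A : K -> Prop) (a b : K) (R : {poly K}) :
  reg_params A a b -> polyIn A R -> R.[b / a] = 0 -> forall j, maxid A R`_j.
Proof.
move=> hab; have [lA [_ [_ [ma [mb _]]]]] := hab; have [sA mA] := lA.
have [Aa Ab] := (proj1 ma, proj1 mb).
have a0 := reg_params_neq0 hab; have [ia [_ pa]] := reg_params_prime hab.
have nab := @reg_params_power _ _ _ _ ^~ hab.
(* Size at most [d] means degree below [d], so one factor [a] is left over. *)
have clear_denom d P : polyIn A P -> (size P <= d)%N ->
    dividesIn A a (a ^+ d * P.[b / a]).
  move=> hP sP; rewrite (horner_coef_wide _ sP) mulr_sumr.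
  apply: big_ind => [||j _]; [exact: (id0 ia) | exact: (idD ia) |].
  exists (a ^+ (d - j.+1) * b ^+ j * P`_j); split.
    by do !apply: (srM sA) => //; apply: srX.
  rewrite -{1}(subnKC (ltn_ord j)) exprD exprS expr_div_n; field; exact: expf_neq0.
elim: {R}(size R) {-2}R (leqnn (size R)) => [|d IHd] R sR hR R0 j.
  by rewrite nth_default ?(leq_trans sR) //; apply: (id0 mA).
set c := R`_d; set R' := take_poly d R.
have RE : R = R' + c *: 'X^d.
  apply/polyP => i; rewrite coefD coefZ coefXn coef_take_poly.
  case: ltngtP => [_|di|->]; rewrite ?mulr0 ?addr0 ?add0r ?mulr1 //.
  by rewrite nth_default // (leq_trans sR).
have hR' : polyIn A R' := polyIn_take sA d hR.
have sR' : (size R' <= d)%N by apply: size_take_poly.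
have R't : R'.[b / a] = - c * (b / a) ^+ d.
  by apply/eqP; rewrite mulNr -addr_eq0 -R0 RE hornerD hornerZ hornerXn.
have /pa[||[s [As cE]]|/nab//] : dividesIn A a (c * b ^+ d).
- rewrite (_ : _ * _ = - 1 * (a ^+ d * R'.[b / a])).
    by apply: (idMl ia); [apply: (srN sA); apply: sr1 | apply: clear_denom].
  by rewrite R't expr_div_n; field; exact: expf_neq0.
- exact: hR.
- exact: srX.
have mc : maxid A c by rewrite cE; apply: (idMr mA).
have [/eqP dj|dj] := eqVneq j d; first by rewrite (eqP dj).
have -> : R`_j = R'`_j by rewrite RE coefD coefZ coefXn (negPf dj) mulr0 addr0.
case: d IHd c R' {RE} sR sR' R't hR' dj cE mc => [|d] IHd c R' sR sR' R't hR' dj cE mc.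
  by rewrite nth_default ?(leq_trans sR') //; apply: (id0 mA).
have msb : maxid A (s * b) by apply: (idMl mA).
have hs : polyIn A ((s * b) *: 'X^d).
  by apply: polyInZ => //; [apply: srM | apply: polyInXn].
have := IHd (R' + (s * b) *: 'X^d) _ (polyInD sA hR' hs) _ j.
rewrite coefD coefZ => h; rewrite -[R'`_j](addrK (s * b * 'X^d`_j)).
apply: (idB sA mA); last by apply: (idMr mA) => //; apply: polyInXn.
apply: h.
  rewrite (leq_trans (size_polyD _ _)) // geq_max sR' (leq_trans (size_scale_leq _ _)) //.
  by rewrite size_polyXn.
by rewrite hornerD hornerZ hornerXn R't cE exprS; field.
Qed.

(** * Quadratic transforms along a valuation *)

Section Valuation.
Variables (k K : fieldType) (f : {rmorphism k -> K}) (nu : K -> rat).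
Hypothesis hval : is_k_valuation f nu.

Lemma nuM a b : a != 0 -> b != 0 -> nu (a * b) = nu a + nu b.
Proof. by case: hval => h _; apply: h. Qed.
Lemma nu1 : nu 1 = 0.
Proof.
have := nuM (oner_neq0 K) (oner_neq0 K); rewrite mulr1 => /eqP.
by rewrite -subr_eq0 opprD addNKr oppr_eq0 => /eqP.
Qed.
Lemma nuV a : a != 0 -> nu a^-1 = - nu a.
Proof.
move=> a0; have := @nuM a a^-1; rewrite invr_eq0 divff // nu1 => /(_ a0 a0) h.
by apply/eqP; rewrite -addr_eq0 addrC -h.
Qed.
Lemma nuX a n : a != 0 -> nu (a ^+ n) = n%:R * nu a.
Proof.
move=> a0; elim: n => [|n IHn]; first by rewrite expr0 nu1 mul0r.
by rewrite exprS nuM ?expf_neq0 // IHn [n.+1%:R]mulrS; ring.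
Qed.
Lemma nu_div a b : a != 0 -> b != 0 -> nu (a / b) = nu a - nu b.
Proof. by move=> a0 b0; rewrite nuM ?invr_eq0 // nuV. Qed.

Lemma inV_fk c : inV nu (f c).
Proof.
have [->|c0] := eqVneq c 0; first by left; rewrite rmorph0.
by right; case: hval => _ [_ h]; rewrite h.
Qed.
Lemma inmV_inV z : inmV nu z -> inV nu z.
Proof. by case; [left | right; apply: ltW]. Qed.

Lemma inVM a b : inV nu a -> inV nu b -> inV nu (a * b).
Proof.
case=> [->|na]; first by rewrite mul0r; left.
case=> [->|nb]; first by rewrite mulr0; left.
have [->|a0] := eqVneq a 0; first by rewrite mul0r; left.
have [->|b0] := eqVneq b 0; first by rewrite mulr0; left.
by right; rewrite nuM //; lra.
Qed.
Lemma inmVM a b : inV nu a -> inmV nu b -> inmV nu (a * b).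
Proof.
case=> [->|na]; first by rewrite mul0r; left.
case=> [->|nb]; first by rewrite mulr0; left.
have [->|a0] := eqVneq a 0; first by rewrite mul0r; left.
have [->|b0] := eqVneq b 0; first by rewrite mulr0; left.
by right; rewrite nuM //; lra.
Qed.
Lemma inVD a b : inV nu a -> inV nu b -> inV nu (a + b).
Proof.
have [->|a0] := eqVneq a 0; first by rewrite add0r.
have [->|b0] := eqVneq b 0; first by rewrite addr0.
have [->|ab0] := eqVneq (a + b) 0; first by left.
case=> [/eqP|na]; first by rewrite (negPf a0).
case=> [/eqP|nb]; first by rewrite (negPf b0).
right; case: hval => _ [h _]; apply: le_trans (h a b a0 b0 ab0).
by rewrite le_min na.
Qed.
Lemma inmVD a b : inmV nu a -> inmV nu b -> inmV nu (a + b).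
Proof.
have [->|a0] := eqVneq a 0; first by rewrite add0r.
have [->|b0] := eqVneq b 0; first by rewrite addr0.
have [->|ab0] := eqVneq (a + b) 0; first by left.
case=> [/eqP|na]; first by rewrite (negPf a0).
case=> [/eqP|nb]; first by rewrite (negPf b0).
right; case: hval => _ [h _]; apply: lt_le_trans (h a b a0 b0 ab0).
by rewrite lt_min na.
Qed.
Lemma inmVN a : inmV nu a -> inmV nu (- a).
Proof. by rewrite -mulN1r -(rmorphN1 f); apply: inmVM; apply: inV_fk. Qed.
Lemma inmVB a b : inmV nu a -> inmV nu b -> inmV nu (a - b).
Proof. by move=> ma mb; apply: inmVD => //; apply: inmVN. Qed.

Lemma inmV_fk c : inmV nu (f c) -> c = 0.
Proof.
case=> [/eqP|]; first by rewrite fmorph_eq0 => /eqP.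
have [//|c0] := eqVneq c 0.
by case: hval => _ [_ h]; rewrite h // ltxx.
Qed.

Lemma inV_unitP z : inV nu z -> ~ inmV nu z <-> z != 0 /\ nu z = 0.
Proof.
move=> Vz; split=> [nm|[z0 nz] [/eqP|]]; last by rewrite nz ltxx.
  have z0 : z != 0 by apply/eqP => z0; apply: nm; left.
  split=> //; case: Vz => [/eqP|]; first by rewrite (negPf z0).
  by rewrite le_eqVlt => /orP[/eqP //|h]; case: nm; right.
by rewrite (negPf z0).
Qed.

Lemma inmV1 : ~ inmV nu 1.
Proof. by apply/inV_unitP; rewrite ?oner_neq0 ?nu1 //; right; rewrite nu1. Qed.

Lemma inV1 : inV nu 1. Proof. by right; rewrite nu1. Qed.

Lemma inV_div a b : inV nu a -> inV nu b -> ~ inmV nu b -> inV nu (a / b).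
Proof.
move=> Va Vb /(inV_unitP Vb)[b0 nb]; apply: inVM => //.
by right; rewrite nuV // nb oppr0.
Qed.

Lemma inmV_mul_not a b : inV nu a -> inV nu b -> ~ inmV nu a -> inmV nu (a * b) -> inmV nu b.
Proof.
move=> Va Vb /(inV_unitP Va)[a0 na] mab; rewrite -[b](mulKf a0).
by apply: inmVM => //; right; rewrite nuV // na oppr0.
Qed.

Lemma nu_unitIn (A : K -> Prop) g : dominated nu A -> unitIn A g -> nu g = 0.
Proof.
move=> [AV _] [Ag [g0 Ag']].
have [/eqP|n1] := AV _ Ag; first by rewrite (negPf g0).
have [/eqP|] := AV _ Ag'; first by rewrite invr_eq0 (negPf g0).
by rewrite nuV // => n2; apply/eqP; rewrite eq_le n1 andbT -oppr_ge0.
Qed.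

Lemma maxidP (A : K -> Prop) z : dominated nu A -> A z -> maxid A z <-> inmV nu z.
Proof.
move=> dA Az; split; first by case: dA => _; apply.
move=> mz; split=> // uz; have nz := nu_unitIn dA uz; move: uz => [_ [z0 _]].
by case: mz => [/eqP|]; rewrite ?(negPf z0) // nz ltxx.
Qed.

Definition blowup_ring (A : K -> Prop) (t z : K) : Prop :=
  exists r s, adjoin A t r /\ adjoin A t s /\ ~ inmV nu s /\ z = r / s.

Section Blowup.
Hypothesis hres : residue_field_k f nu.
Variables (A : K -> Prop) (a b : K) (c : k).
Hypothesis hab : reg_params A a b.
Hypothesis dA : dominated nu A.
Hypothesis kA : forall e, A (f e).
Let t : K := b / a.
Hypothesis ht : inmV nu (t - f c).

Let lA : local_ring A := proj1 hab.
Let sA : subring A := proj1 lA.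
Let mA : ideal A (maxid A) := proj2 lA.
Let C := adjoin A t.
Let B := blowup_ring A t.
Let sC : subring C := subring_adjoin sA t.
Let Aa : A a. Proof. by case: hab => _ [_ [_ [[]]]]. Qed.
Let Ab : A b. Proof. by case: hab => _ [_ [_ [_ [[]]]]]. Qed.
Let a0 : a != 0 := reg_params_neq0 hab.
Let ta : t * a = b. Proof. by rewrite /t divfK. Qed.
Let CA z : A z -> C z. Proof. exact: adjoin_id. Qed.
Let Ct : C t. Proof. exact: adjoin_gen. Qed.

Let Vt : inV nu t.
Proof. by rewrite -[t](subrK (f c)); apply: inVD; [apply: inmV_inV | apply: inV_fk]. Qed.

Let CV z : C z -> inV nu z.
Proof.
move=> [r [d [Ar ->]]]; apply: big_ind => [||j _]; [by left | exact: inVD |].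
apply: inVM; first by case: dA => h _; apply: h.
elim: (nat_of_ord j) => [|n IHn]; first by rewrite expr0; apply: inV1.
by rewrite exprS; apply: inVM.
Qed.

Let BC z : C z -> B z.
Proof.
move=> Cz; exists z, 1; rewrite divr1; split=> //.
by split; [apply: sr1 sC | split=> //; apply: inmV1].
Qed.

Let den_neq0 s : C s -> ~ inmV nu s -> s != 0.
Proof. by move=> Cs /(inV_unitP (CV Cs))[]. Qed.

Let denM s s' : C s -> C s' -> ~ inmV nu s -> ~ inmV nu s' -> ~ inmV nu (s * s').
Proof.
by move=> Cs Cs' ns ns' /(inmV_mul_not (CV Cs) (CV Cs') ns).
Qed.

Lemma subring_blowup : subring B.
Proof.
split; first exact: BC (sr0 sC).
split; first exact: BC (sr1 sC).
split=> _ _ [r [s [Cr [Cs [ns ->]]]]] [r' [s' [Cr' [Cs' [ns' ->]]]]].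
  exists (r * s' - r' * s), (s * s'); split; first by apply: srB => //; apply: srM.
  split; first exact: srM.
  split; first exact: denM.
  by have := den_neq0 Cs ns; have := den_neq0 Cs' ns'; move=> *; field; apply/andP.
exists (r * r'), (s * s'); split; first exact: srM.
split; first exact: srM.
split; first exact: denM.
by rewrite invfM; ring.
Qed.
Let sB := subring_blowup.

Let BV z : B z -> inV nu z.
Proof. by move=> [r [s [/CV Vr [/CV Vs [ns ->]]]]]; apply: inV_div. Qed.

Let unitB z : B z -> ~ inmV nu z -> unitIn B z.
Proof.
move=> Bz nz; split=> //; have [z0 _] := (inV_unitP (BV Bz)).1 nz; split=> //.
case: Bz nz => r [s [Cr [Cs [ns ->]]]] nz; exists s, r; split=> //; split=> //.
split; last by rewrite invf_div.
move=> mr; apply: nz; rewrite mulrC; apply: inmVM => //.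
by right; have [s0 ns0] := (inV_unitP (CV Cs)).1 ns; rewrite nuV // ns0 oppr0.
Qed.

Let nunitB z : unitIn B z -> ~ inmV nu z.
Proof.
move=> [Bz [z0 Bz']] mz; apply: inmV1; rewrite -(mulVf z0); apply: inmVM => //.
exact: BV.
Qed.

Let maxidB z : maxid B z <-> B z /\ inmV nu z.
Proof.
split=> [[Bz uz]|[Bz mz]]; split=> //; last by move/nunitB.
by apply: NNPP => /(unitB Bz).
Qed.

Lemma dominated_blowup : dominated nu B.
Proof. by split=> [z|z /maxidB[]//]; apply: BV. Qed.

Lemma local_blowup : local_ring B.
Proof.
split; first exact: sB.
split=> [z []//|].
split; first by apply/maxidB; split; [apply: sr0 sB | left].
split=> [x y /maxidB[Bx mx] /maxidB[By my]|r x Br /maxidB[Bx mx]]; apply/maxidB.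
  by split; [apply: srD | apply: inmVD].
by split; [apply: srM | apply: inmVM => //; apply: BV].
Qed.

Lemma noetherian_blowup : noetherian B.
Proof.
have nA : noetherian A by case: hab => _ [].
apply: (localization_noetherian (U := fun s => C s /\ ~ inmV nu s) sC sB BC).
- move=> s [Cs ns]; split=> //; split; first exact: den_neq0.
  by have [_ []] := unitB (BC Cs) (fun h => ns h).
- by move=> z [r [s [Cr [Cs [ns ->]]]]]; exists r, s.
exact: adjoin_noetherian.
Qed.

Let residueA z : A z -> exists e, maxid A (z - f e).
Proof.
move=> Az; have [|e he] := hres (z := z); first by case: dA => h _; apply: h.
by exists e; apply/(maxidP dA) => //; apply: srB.
Qed.

Let maxidA_dvd z : maxid A z -> dividesIn C a z.
Proof.
case: hab => _ [_ [_ [_ [_ mE]]]] /mE[r [s [Ar [As ->]]]].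
exists (r + s * t); split; first by apply: (srD sC); [apply: CA | apply: (srM sC) => //; apply: CA].
by rewrite -ta; ring.
Qed.

(** Coefficients are constants modulo the maximal ideal of [A], whose elements [a] divides in [C],
    and [t] is congruent to [f c]. *)
Let residueC z : C z -> exists e r s, C r /\ C s /\ z = f e + r * a + s * (t - f c).
Proof.
move=> [z' [d [Az ->]]]; 
pose T z := exists e r s, C r /\ C s /\ z = f e + r * a + s * (t - f c).
apply: (big_ind T) => [|x y|j _]; rewrite /T.
- exists 0, 0, 0; rewrite rmorph0; split; first exact: (sr0 sC).
  by split; [exact: (sr0 sC) | ring].
- move=> [e [r [s [Cr [Cs ->]]]]] [e' [r' [s' [Cr' [Cs' ->]]]]].
  exists (e + e'), (r + r'), (s + s'); rewrite rmorphD.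
  by split; [exact: (srD sC) | split; [exact: (srD sC) | ring]].
move: (z' j) (Az j) => w Aw; elim: (nat_of_ord j) => [|n [e [r [s [Cr [Cs IHn]]]]]].
  have [e /maxidA_dvd[r [Cr zE]]] := residueA Aw.
  exists e, r, 0; split=> //; split; first exact: (sr0 sC).
  by rewrite expr0 -[w](subrK (f e)) zE; ring.
exists (e * c), (r * t), (s * t + f e); split; first exact: (srM sC).
split; first by apply: (srD sC); [apply: (srM sC) | apply/CA/kA].
by rewrite exprSr mulrA IHn rmorphM; ring.
Qed.

Let maP : inmV nu a.
Proof. by case: dA => _; apply; case: hab => _ [_ [_ []]]. Qed.

Let maxid_gen z : maxid B z <-> exists r s, B r /\ B s /\ z = r * a + s * (t - f c).
Proof.
split.
  move=> /maxidB[[z' [d [Cz [Cd [nd ->]]]]] mz].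
  have [e [r [s [Cr [Cs zE]]]]] := residueC Cz.
  have [d0 _] := (inV_unitP (CV Cd)).1 nd.
  (* The constant part of the numerator has positive value, and a nonzero constant has value 0. *)
  have e0 : e = 0.
    apply: inmV_fk; rewrite (_ : f e = d * (z' / d) - (r * a + s * (t - f c))).
      apply: inmVB; first by apply: inmVM => //; apply: CV.
      by apply: inmVD; apply: inmVM => //; apply: CV.
    by rewrite [d * _]mulrC divfK // zE; ring.
  have Bd : B d^-1 by have [_ []] := unitB (BC Cd) nd.
  exists (r / d), (s / d); split; first by apply: (srM sB) => //; apply: BC.
  split; first by apply: (srM sB) => //; apply: BC.
  by rewrite zE e0 rmorph0; ring.
move=> [r [s [Br [Bs ->]]]]; have Bf := BC (CA (kA c)).
apply/maxidB; split.
  by apply: (srD sB); apply: (srM sB) => //; [|apply: (srB sB) => //]; apply: BC => //; apply: CA.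
by apply: inmVD; apply: inmVM => //; apply: BV.
Qed.

(* Residues of the coefficients: reduction modulo the maximal ideal of A identifies C / aC with
   the polynomial ring over k, by quasi-regularity of (a, b). *)
Let red (P : {poly K}) (Q : {poly k}) := polyIn A P /\ forall j, inmV nu (P`_j - f Q`_j).

Let redE P : polyIn A P -> exists Q, red P Q.
Proof.
move=> hP; 
pose g j := epsilon (inhabits 0) (fun e => inmV nu (P`_j - f e)).
have hg j : inmV nu (P`_j - f (g j)).
  apply: (epsilon_spec (inhabits 0) (fun e => inmV nu (P`_j - f e))).
  by have [e he] := residueA (hP j); exists e; apply/(maxidP dA) => //; case: he.
exists (\poly_(j < size P) g j); split=> // j; rewrite coef_poly.
by case: ltnP => // sj; rewrite nth_default // rmorph0 subrr; left.
Qed.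

Let redM P Q P' Q' : red P Q -> red P' Q' -> red (P * P') (Q * Q').
Proof.
move=> [hP hQ] [hP' hQ']; split=> [|j]; first exact: polyInM.
rewrite !coefM rmorph_sum -sumrB; apply: big_ind => [||i _]; [by left|exact: inmVD|].
rewrite rmorphM.
rewrite (_ : _ - _ = P`_i * (P'`_(j - i) - f Q'`_(j - i)) + f Q'`_(j - i) * (P`_i - f Q`_i)).
  apply: inmVD; apply: inmVM => //; last exact: inV_fk.
  by case: dA => h _; apply: h.
ring.
Qed.

(** If [P.[t] = a * R.[t]], then [P - a *: R] vanishes at [t] and quasi-regularity puts its
    coefficients, hence those of [P], in the maximal ideal. *)
Let red_dvd P Q : red P Q -> Q = 0 <-> dividesIn C a P.[t].
Proof.
move=> [hP hQ]; split=> [Q0|[_ [/(adjoinP sA)[R [hR ->]] E]]].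
  have iC := ideal_dvd sC (CA Aa); rewrite horner_coef.
  apply: big_ind => [||j _]; [exact: (id0 iC)|exact: (idD iC)|].
  apply: (idMr iC); first exact: srX.
  apply/maxidA_dvd/(maxidP dA) => //.
  by have := hQ j; rewrite Q0 coef0 rmorph0 subr0.
apply/polyP => j; rewrite coef0; apply: inmV_fk.
have hR' := polyInB sA hP (polyInZ sA Aa hR).
have := quasi_regular hab hR' _ j.
rewrite hornerD hornerN hornerZ E subrr => /(_ erefl) /(maxidP dA (hR' j)).
rewrite coefB coefZ => mj.
rewrite (_ : f _ = P`_j - a * R`_j + R`_j * a - (P`_j - f Q`_j)); last by ring.
apply: inmVB => //; apply: inmVD => //; apply: inmVM => //.
by case: dA => h _; apply: h.
Qed.

Let dvdC_prime r s : C r -> C s -> dividesIn C a (r * s) -> dividesIn C a r \/ dividesIn C a s.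
Proof.
move=> /(adjoinP sA)[P [hP ->]] /(adjoinP sA)[P' [hP' ->]].
have [[Q hQ] [Q' hQ']] := (redE hP, redE hP').
rewrite -hornerM => /(red_dvd (redM hQ hQ')) /eqP; rewrite mulf_eq0.
by case/orP => /eqP; [move/(red_dvd hQ); left | move/(red_dvd hQ'); right].
Qed.

(** The prime [a] has positive value, so it divides no admissible denominator. *)
Let dvdB_num r s : C r -> C s -> ~ inmV nu s -> dividesIn B a (r / s) -> dividesIn C a r.
Proof.
move=> Cr Cs ns [_ [[r' [s' [Cr' [Cs' [ns' ->]]]]] E]].
have [s0 s'0] := (den_neq0 Cs ns, den_neq0 Cs' ns').
case: (@dvdC_prime r s') => //; last first.
  by move=> [h [Ch s'E]]; case: ns'; rewrite s'E mulrC; apply: inmVM => //; apply: CV.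
exists (r' * s); split; first exact: srM.
by rewrite -[r](divfK s0) E; field.
Qed.

Let prime_blowup : prime_ideal B (dividesIn B a).
Proof.
split; first exact/(ideal_dvd sB)/BC/CA.
split=> [|_ _ [r [s [Cr [Cs [ns ->]]]]] [r' [s' [Cr' [Cs' [ns' ->]]]]]].
  by move=> [h [Bh E]]; apply: inmV1; rewrite E mulrC; apply: inmVM => //; apply: BV.
have dvdB x d : C d -> ~ inmV nu d -> dividesIn C a x -> dividesIn B a (x / d).
  by move=> Cd nd [h [Ch ->]]; exists (h / d); rewrite mulrA; split=> //; exists h, d.
rewrite mulrACA -invfM.
move=> /(dvdB_num (srM sC Cr Cr') (srM sC Cs Cs') (denM Cs Cs' ns ns'))[h [Ch E]].
case: (@dvdC_prime r r') => //; first by exists h.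
  by left; apply: dvdB.
by right; apply: dvdB.
Qed.

Lemma blowup_reg_params : reg_params B a (t - f c).
Proof.
apply: reg_params_intro local_blowup noetherian_blowup maxid_gen prime_blowup a0 _.
(* [a] does not divide [t - f c], because the reduction ['X - c%:P] is nonzero. *)
have Ctc : C (t - f c) by apply: (srB sC) => //; apply/CA/kA.
rewrite -[t - f c]divr1 => /(dvdB_num Ctc (sr1 sC) inmV1).
have tE : t - f c = ('X - (f c)%:P).[t] by rewrite hornerD hornerN hornerX hornerC.
rewrite tE -(red_dvd (Q := 'X - c%:P)) => [/eqP|]; first by rewrite polyXsubC_eq0.
split; first by apply: (polyInB sA); [apply: polyInX | apply: polyInC].
move=> j; left; rewrite -coef_map rmorphB /= map_polyX map_polyC /= subrr //.
Qed.

Lemma sub_blowup z : A z -> B z. Proof. by move=> Az; apply/BC/CA. Qed.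
Lemma blowup_gen : B t. Proof. exact: BC. Qed.
End Blowup.
End Valuation.

(** * Euclidean chains of quadratic transforms *)

Lemma eps_rec_fuel m n p q : (q < m)%N -> (q < n)%N -> eps_rec m p q = eps_rec n p q.
Proof.
elim: m n p q => [//|m IHm] [//|n] p q qm qn /=.
case: eqP => // /eqP; rewrite -lt0n => q0; congr addn.
by apply: IHm; apply: leq_trans (ltn_pmod _ q0) _.
Qed.

Lemma eps_ltn p q : (0 < p)%N -> (p < q)%N -> eps p q = eps q p.
Proof.
move=> p0 pq; rewrite {1}/eps /= divn_small // modn_small //.
by rewrite (gtn_eqF (ltn_trans p0 pq)) add0n; apply: eps_rec_fuel.
Qed.

Lemma epsC p q : (0 < p)%N -> (0 < q)%N -> eps p q = eps q p.
Proof.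
move=> p0 q0; case: (ltngtP p q) => [pq|qp|->//]; first exact: eps_ltn.
by rewrite -eps_ltn.
Qed.

(** Turns the sum of quotients into a count of subtractions, one per transform. *)
Lemma eps_subl p q : (0 < q)%N -> (q <= p)%N -> eps p q = (eps (p - q) q).+1.
Proof.
move=> q0 qp; rewrite /eps /= (gtn_eqF q0) -{1 2}(subnK qp).
by rewrite divnDr // divnn q0 modnDr addn1 addSn.
Qed.

Lemma eps_subr p q : (0 < p)%N -> (p < q)%N -> eps p q = (eps p (q - p)).+1.
Proof.
move=> p0 pq; rewrite epsC // ?(ltn_trans p0 pq) // eps_subl // 1?ltnW //.
by rewrite epsC // subn_gt0.
Qed.

Section Chains.
Variables (k K : fieldType) (f : {rmorphism k -> K}) (nu : K -> rat).
Hypothesis hval : is_k_valuation f nu.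
Hypothesis hres : residue_field_k f nu.

Definition kdominated (A : K -> Prop) : Prop := dominated nu A /\ forall c, A (f c).

Definition qchain N (A B : K -> Prop) : Prop :=
  exists R, R 0%N = A /\ R N = B /\ forall m, (m < N)%N -> quad_transform nu (R m) (R m.+1).

Lemma qchain1 A B : quad_transform nu A B -> qchain 1 A B.
Proof. by move=> hAB; exists (fun m => if m is 0 then A else B); do 2!split=> //; case. Qed.

Lemma qchain_cons N A A' B : quad_transform nu A A' -> qchain N A' B -> qchain N.+1 A B.
Proof.
move=> hA [R [RA [RB hR]]]; exists (fun m => if m is m'.+1 then R m' else A).
by split=> //; split=> // -[_|m]; [rewrite RA | apply: hR].
Qed.

Lemma unitIn_sub (A B : K -> Prop) g : (forall z, A z -> B z) -> unitIn A g -> unitIn B g.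
Proof. by move=> AB [Ag [g0 Ag']]; split; [apply: AB | split=> //; apply: AB]. Qed.

Lemma quad_step A a b c : reg_params A a b -> kdominated A -> inmV nu (b / a - f c) ->
  exists B, quad_transform nu A B /\ reg_params B a (b / a - f c) /\ kdominated B /\
            (forall z, A z -> B z) /\ B (b / a).
Proof.
move=> hab [dA kA] hc; have sAB := sub_blowup hval hab.
exists (blowup_ring nu A (b / a)); split.
  exists a, b; split=> //; left; split=> //.
  by rewrite -[b / a](subrK (f c)); apply: (inVD hval); [apply: inmV_inV | apply: (inV_fk hval)].
split; first exact: blowup_reg_params.
split; first by split=> [|e]; [apply: (dominated_blowup hval dA hc) | apply/sAB/kA].
by split=> //; apply: (blowup_gen hval hab).
Qed.

(* Every step of the Euclidean algorithm on (p, q) is mirrored by a quadratic transform dividing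
   one parameter by the other; neither changes z = b ^+ q / a ^+ p * g. Once p = q = 1, the last
   transform is centred at the residue of z. *)
Lemma euclid_chain p q A a b w g lam : (0 < p)%N -> (0 < q)%N -> coprime p q ->
  reg_params A a b -> kdominated A -> 0 < w -> nu a = q%:R * w -> nu b = p%:R * w ->
  unitIn A g -> inmV nu (b ^+ q / a ^+ p * g - f lam) ->
  exists B u g1 g2, qchain (eps p q) A B /\ reg_params B u (b ^+ q / a ^+ p * g - f lam) /\
    kdominated B /\ (forall z, A z -> B z) /\ nu u = w /\
    unitIn B g1 /\ a = u ^+ q * g1 /\ unitIn B g2 /\ b = u ^+ p * g2.
Proof.
elim: {p q}(p + q)%N {-2}p {-2}q (leqnn (p + q)) A a b => [|N IHN] p q pqN A a b
  p0 q0 pq hab dA w0 na nb ug hz.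
  by move: pqN p0; rewrite leqn0 addn_eq0 => /andP[/eqP ->].
have a0 := reg_params_neq0 hab; have b0 := reg_params_neq0 (reg_params_sym hab).
case: (ltngtP p q) => [pq_lt|qp_lt|pq_eq].
- have nab : nu (a / b) = (q - p)%:R * w.
    by rewrite (nu_div hval) // na nb natrB ?(ltnW pq_lt) //; ring.
  (* [a / b] has positive value, so its residue is 0 and it is itself the new parameter. *)
  have [|B [AB [hB [dB [sAB _]]]]] := quad_step (c := 0) (reg_params_sym hab) dA.
    right; rewrite rmorph0 subr0 nab mulr_gt0 // ltr0n subn_gt0 //.
  rewrite rmorph0 subr0 in hB.
  have zE : b ^+ (q - p) / (a / b) ^+ p = b ^+ q / a ^+ p.
    rewrite expr_div_n -{2}(subnK (ltnW pq_lt)) exprD.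
    by field; rewrite !expf_neq0.
  have := IHN p (q - p)%N _ B (a / b) b p0 _ _ (reg_params_sym hB) dB w0 nab nb.
  rewrite zE => -[|||||D [u [g1 [g2 [BD [hD [dD [sBD [nu_u [ug1 [aE [ug2 bE]]]]]]]]]]]].
  + by lia.
  + by rewrite subn_gt0.
  + by rewrite /coprime -gcdnDr subnK // ltnW.
  + exact: unitIn_sub ug.
  + exact: hz.
  exists D, u, (g1 * g2), g2; rewrite eps_subr //; split; first exact: qchain_cons BD.
  do 3!(split; first by auto); split=> //; split; first by apply: unitInM ug1 ug2; case: hD => -[].
  split=> //; rewrite -[a](divfK b0) aE bE -{2}(subnK (ltnW pq_lt)) exprD; ring.
- have nba : nu (b / a) = (p - q)%:R * w.
    by rewrite (nu_div hval) // na nb natrB ?(ltnW qp_lt) //; ring.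
  have [|B [AB [hB [dB [sAB _]]]]] := quad_step (c := 0) hab dA.
    right; rewrite rmorph0 subr0 nba mulr_gt0 // ltr0n subn_gt0 //.
  rewrite rmorph0 subr0 in hB.
  have zE : (b / a) ^+ q / a ^+ (p - q) = b ^+ q / a ^+ p.
    rewrite expr_div_n -{2}(subnK (ltnW qp_lt)) exprD.
    by field; rewrite !expf_neq0.
  have := IHN (p - q)%N q _ B a (b / a) _ q0 _ hB dB w0 na nba.
  rewrite zE => -[|||||D [u [g1 [g2 [BD [hD [dD [sBD [nu_u [ug1 [aE [ug2 bE]]]]]]]]]]]].
  + by lia.
  + by rewrite subn_gt0.
  + by rewrite /coprime gcdnC -gcdnDr subnK ?(ltnW qp_lt) // gcdnC.
  + exact: unitIn_sub ug.
  + exact: hz.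
  exists D, u, g1, (g2 * g1); rewrite eps_subl // 1?ltnW //; split; first exact: qchain_cons BD.
  do 6!(split; first by auto); split; first by apply: unitInM ug2 ug1; case: hD => -[].
  rewrite -[b](divfK a0) bE aE -{2}(subnK (ltnW qp_lt)) exprD; ring.
have {pq_eq pqN} [p1 q1] : p = 1%N /\ q = 1%N.
  by move: pq; rewrite -pq_eq /coprime gcdnn => /eqP.
subst p q; rewrite !expr1 !mul1r in hz na nb *.
rewrite (mulrAC b) in hz *.
(* Replacing [b] by [b * g] makes the quotient to be centred equal to [z] itself. *)
have hag := reg_params_unit hab ug.
have [B [AB [hB [dB [sAB Bt]]]]] := quad_step hag dA hz.
have ugB := unitIn_sub sAB ug.
have g0 : g != 0 by case: ug => _ [].
have nt : nu (b * g / a) = 0.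
  rewrite (nu_div hval) ?mulf_neq0 // (nuM hval) // (nu_unitIn hval _ ug); last by case: dA.
  by rewrite na nb addr0 subrr.
have ut : unitIn B (b * g / a).
  case: (unitIn_or_maxid Bt) => // /(proj2 (proj1 dB))[/eqP|].
    by rewrite !mulf_eq0 (negPf b0) (negPf g0) invr_eq0 (negPf a0).
  by rewrite nt ltxx.
exists B, a, 1, (b * g / a * g^-1); split; first exact: qchain1.
have sB : subring B by case: hB => -[].
do 4!(split; first by auto); split; first exact: unitIn1.
split; first by rewrite mulr1.
split; first by apply: unitInM => //; apply: unitInV.
by field; apply/andP.
Qed.

End Chains.

(** * From one free point to the next *)

Section Invariant.
Variables (k K : fieldType) (f : {rmorphism k -> K}) (nu : K -> rat).
Hypothesis hval : is_k_valuation f nu.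
Hypothesis hres : residue_field_k f nu.
Variables (x y : K) (T : nat -> K) (p q : nat -> nat) (n : nat -> nat -> nat) (lam : nat -> k).
Hypothesis hT : jumping f nu x y T p q n lam.
Hypothesis hx : nu x = 1.

Definition umonomial (B : K -> Prop) (u z : K) : Prop :=
  exists e g, unitIn B g /\ z = u ^+ e * g.

Lemma umonomialM B u z w : subring B -> umonomial B u z -> umonomial B u w ->
  umonomial B u (z * w).
Proof.
move=> sB [e [g [ug ->]]] [e' [g' [ug' ->]]]; exists (e + e')%N, (g * g').
by split; [apply: unitInM | rewrite exprD; ring].
Qed.
Lemma umonomial1 B u : subring B -> umonomial B u 1.
Proof. by move=> sB; exists 0%N, 1; rewrite expr0 mulr1; split=> //; apply: unitIn1. Qed.
Lemma umonomialX B u z m : subring B -> umonomial B u z -> umonomial B u (z ^+ m).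
Proof.
move=> sB hz; elim: m => [|m IHm]; first by rewrite expr0; apply: umonomial1.
by rewrite exprS; apply: umonomialM.
Qed.
Lemma umonomial_sub A B u v z e g : subring B -> (forall w, A w -> B w) ->
  unitIn B g -> u = v ^+ e * g -> umonomial A u z -> umonomial B v z.
Proof.
move=> sB AB ug uE [m [h [uh ->]]]; exists (e * m)%N, (g ^+ m * h).
rewrite uE exprMn exprM mulrA; split=> //.
by apply: unitInM (unitIn_sub AB uh) => //; apply: unitInX.
Qed.

(** The exponents of the [T j] are left existential: as [xi] has value [1 / Q_i] and units have
    value 0, they are recovered as [Q_i * nu (T j)]. The factorization of [T i.+1] feeds the next
    step. *)
Definition stage i (B : K -> Prop) (xi yi : K) : Prop :=
  reg_params B xi yi /\ kdominated f nu B /\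
  nu xi = (Qprod q i)%:R^-1 /\
  nu yi = (Qprod q i)%:R^-1 * ((p i.+1)%:R / (q i.+1)%:R) /\
  (forall j, (j <= i)%N -> umonomial B xi (T j)) /\
  (exists h, umonomial B xi h /\ T i.+1 = yi * h) /\
  ((0 < i)%N -> yi = T i.+1 / \prod_(j < i) T j ^+ n i j).

Lemma Qprod_gt0 i : (0 < Qprod q i)%N.
Proof.
rewrite /Qprod big_nat prodn_cond_gt0 // => j /andP[j0 _].
by case: hT => _ [_ [h _]]; case: (h j j0) => _ [].
Qed.

Lemma QprodS i : Qprod q i.+1 = (Qprod q i * q i.+1)%N.
Proof. by rewrite /Qprod big_nat_recr. Qed.

Lemma umonomial_prod i B u : subring B -> (forall j, (j <= i)%N -> umonomial B u (T j)) ->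
  umonomial B u (\prod_(j < i.+1) T j ^+ n i.+1 j).
Proof.
move=> sB hu; apply: big_ind => [||j _]; first exact: umonomial1.
  by move=> *; apply: umonomialM.
by apply: umonomialX => //; apply: hu; rewrite -ltnS.
Qed.

Lemma stage_step i B xi yi : stage i B xi yi ->
  exists B' x' y', qchain nu (eps (p i.+1) (q i.+1)) B B' /\ stage i.+1 B' x' y'.
Proof.
move=> [hB [dB [nxi [nyi [hTj [[h [[E [g [ug hE]]] TE]] _]]]]]].
have sB : subring B by case: hB => -[].
have [_ [_ [hpq [_ hrec]]]] := hT.
have [p0 [q0 cpq]] := hpq i.+1 isT.
have [_ [hsum [hres1 [TSE nTS]]]] := hrec i.+1 isT.
set M := \prod_(j < i.+1) _ in hres1 TSE.
have hM : umonomial B xi M by apply: umonomial_prod.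
have [x0 y0] := (reg_params_neq0 hB, reg_params_neq0 (reg_params_sym hB)).
have Q0 := Qprod_gt0 i.
have Q0' : (Qprod q i)%:R != 0 :> rat by rewrite pnatr_eq0 -lt0n.
have q0' : (q i.+1)%:R != 0 :> rat by rewrite pnatr_eq0 -lt0n.
(* The common measure of the two values, and the value of the next exceptional parameter. *)
pose w : rat := (Qprod q i.+1)%:R^-1.
have w0 : 0 < w by rewrite invr_gt0 ltr0n Qprod_gt0.
have nxw : nu xi = (q i.+1)%:R * w by rewrite nxi /w QprodS natrM; field; apply/andP.
have nyw : nu yi = (p i.+1)%:R * w by rewrite nyi /w QprodS natrM; field; apply/andP.
have unz z : unitIn B z -> z != 0 /\ nu z = 0.
  by move=> uz; split; [case: uz => _ [] | apply: (nu_unitIn hval _ uz); case: dB].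
have umon0 z : umonomial B xi z -> z != 0.
  by move=> [e [c [/unz[c0 _] ->]]]; rewrite mulf_neq0 // expf_neq0.
have nM : nu M = \sum_(j < i.+1) (n i.+1 j)%:R * nu (T j).
  have hTj0 (j : 'I_i.+1) : T j != 0 by apply/umon0/hTj; rewrite -ltnS.
  suff [] : M != 0 /\ nu M = \sum_(j < i.+1) (n i.+1 j)%:R * nu (T j) by [].
  rewrite /M; apply: (big_ind2 (fun a s => a != 0 /\ nu a = s)).
  - by rewrite oner_neq0 (nu1 hval).
  - by move=> a s b t [a0 <-] [b0 <-]; rewrite mulf_neq0 // (nuM hval).
  - by move=> j _; rewrite expf_neq0 // (nuX hval).
have [N [G [uG ME]]] := hM.
have [g0 ng] := unz _ ug; have [G0 nG] := unz _ uG.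
(* Compare values in units of [w]: [q * nu (T i.+1) = nu M] reads [q * (p + E * q) = N * q]. Hence
   the powers of [xi] in [T i.+1 ^+ q i.+1 / M] collapse to [xi ^- p i.+1]. *)
have NE : N = (p i.+1 + E * q i.+1)%N.
  move: hsum; rewrite -nM TE hE ME !(nuM hval) ?mulf_neq0 ?expf_neq0 // !(nuX hval) //.
  rewrite ng nG nxw nyw !addr0 => hN; apply/eqP; rewrite -(eqr_nat rat) natrD natrM.
  by apply/eqP; apply: (mulIf (mulf_neq0 q0' (lt0r_neq0 w0))); rewrite -hN; ring.
pose g' := g ^+ q i.+1 / G.
have ug' : unitIn B g' by apply: unitInM; [|apply: unitInX|apply: unitInV].
have zE : T i.+1 ^+ q i.+1 / M = yi ^+ q i.+1 / xi ^+ p i.+1 * g'.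
  rewrite TE hE ME NE exprD !exprMn -exprM /g'; field.
  by rewrite G0 !expf_neq0.
have hz := hres1; rewrite zE in hz.
have [B' [u [g1 [g2 [hch [hB' [dB' [sBB' [nuu [ug1 [xE [ug2 yE]]]]]]]]]]]] :=
  euclid_chain hval hres p0 q0 cpq hB dB w0 nxw nyw ug' hz.
have sB' : subring B' by case: hB' => -[].
rewrite -zE in hB'; set y' := _ - _ in hB'.
have M0 : M != 0 by apply: umon0.
have TSE' : T i.+2 = y' * M by rewrite TSE /y' mulrBl divfK // mulrC.
have sub_umon z : umonomial B xi z -> umonomial B' u z := umonomial_sub sB' sBB' ug1 xE.
have y'0 : y' != 0 := reg_params_neq0 (reg_params_sym hB').
exists B', u, y'; split=> //; split=> //; split=> //; split=> //; split.
  have -> : y' = T i.+2 / M by rewrite TSE' mulfK.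
  rewrite (nu_div hval) ?TSE' ?mulf_neq0 // -TSE' nTS hsum -nM; ring.
split.
  (* [T i.+1] becomes a monomial only now, because [yi] has turned into [u ^+ p i.+1] times a
     unit. *)
  move=> j; rewrite leq_eqVlt => /orP[/eqP->|]; last by rewrite ltnS => /hTj/sub_umon.
  rewrite TE; apply: umonomialM => //; first by exists (p i.+1), g2.
  by apply: sub_umon; exists E, g.
split; first by exists M; split=> //; apply: sub_umon.
by rewrite TSE' mulfK.
Qed.

(** A prime containing a power of [u] times a unit contains [u], hence [x], whose exponent in [u] is
    positive because its value is. *)
Lemma supported_umonomial B u z : subring B -> B u -> umonomial B u x -> x != 0 ->
  0 < nu x -> dominated nu B -> umonomial B u z -> supported_on_E B x z.
Proof.
move=> sB Bu [[|e] [g [ug xE]]] x0 nx dB [m [h [[Bh [h0 Bh']] ->]]] P pP.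
  by move: nx; rewrite xE expr0 mul1r (nu_unitIn hval dB ug) ltxx.
have [iP [nP1 Pp]] := pP.
move=> Pz; have {Pz} : P (u ^+ m).
  by rewrite -[_ ^+ m](mulfK h0); apply: (idMr iP).
case: m => [|m]; first by rewrite expr0.
have Pu : P u -> P x.
  rewrite xE exprS -mulrA => Pu; apply: (idMr iP) => //.
  by case: ug => Bg _; apply: srM => //; apply: srX.
elim: m => [|m IHm]; first by rewrite expr1.
by rewrite exprS => /Pp[||/Pu|/IHm]//; apply: srX.
Qed.

(** Since [x] is a positive power of the prime [xi] times a unit, [(xi)] is the only minimal prime
    over [x]. *)
Lemma stage_conclusion i B xi yi : (0 < i)%N -> stage i B xi yi ->
  is_free B x /\
  (reg_params B xi yi /\
   exceptional_param B x xi /\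
   (forall j, (j <= i)%N ->
     exists e : nat, (e%:R : rat) = (Qprod q i)%:R * nu (T j) /\
     exists g, unitIn B g /\ T j = xi ^+ e * g) /\
   nu xi = ((Qprod q i)%:R)^-1 /\
   yi = T i.+1 / \prod_(j < i) T j ^+ n i j /\
   strict_transform B x (T i.+1) yi /\
   nu yi = ((Qprod q i)%:R)^-1 * ((p i.+1)%:R / (q i.+1)%:R)).
Proof.
move=> i0 [hB [[dB kB] [nxi [nyi [hTj [_ /(_ i0) yE]]]]]].
have lB := proj1 hB; have sB := proj1 lB.
have [x0 y0] := (reg_params_neq0 hB, reg_params_neq0 (reg_params_sym hB)).
have [Bx By] : B xi /\ B yi by case: hB => _ [_ [_ [[? _] [[? _] _]]]].
have hx1 : umonomial B xi x by case: hT => <- _; apply: hTj.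
have xx0 : x != 0.
  have [e [g [[_ [g0 _]] ->]]] := hx1; by rewrite mulf_neq0 // expf_neq0.
have nx : 0 < nu x by rewrite hx.
have supp := supported_umonomial sB Bx hx1 xx0 nx dB.
have px := reg_params_prime hB; have py := reg_params_prime (reg_params_sym hB).
have xi_mon : umonomial B xi xi.
  by exists 1%N, 1; rewrite mulr1; split=> //; apply: unitIn1.
have Q0 : (Qprod q i)%:R != 0 :> rat by rewrite pnatr_eq0 -lt0n Qprod_gt0.
have [e [g [ug xE]]] := hx1.
have e0 : (0 < e)%N.
  case: e xE => // xE; move: nx; rewrite xE expr0 mul1r.
  by rewrite (nu_unitIn hval dB ug) ltxx.
have minx P : prime_ideal B P -> P x -> forall z, dividesIn B xi z -> P z.
  move=> pP Px z [c [Bc ->]]; have iP := proj1 pP; apply: (idMr iP) => //.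
  apply: (prime_power lB pP Bx (n := e)); have [_ [g0 Bg']] := ug.
  by rewrite -[_ ^+ e](mulfK g0) -xE; apply: (idMr iP).
have xix : dividesIn B xi x.
  exists (xi ^+ e.-1 * g); split; first by apply: srM => //; [apply: srX | case: ug].
  by rewrite mulrA -exprS prednK.
split.
  exists (dividesIn B xi); split; first by split=> //; split=> // P pP Px _; apply: minx.
  move=> P [pP [Px Pmin]] z; split; last exact: minx.
  by apply: Pmin => // {}z; apply: minx.
split=> //; split; first by split; [exists yi; left | apply: supp].
split.
  move=> j /hTj[m [c [uc TE]]]; exists m; split; last by exists c.
  have [_ [c0 _]] := uc.
  rewrite TE (nuM hval) ?expf_neq0 // (nuX hval) // (nu_unitIn hval dB uc) addr0 nxi.
  by rewrite mulrCA divff ?mulr1.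
do 2!(split; first by []); split; last by [].
split=> //; split.
  have hM : umonomial B xi (\prod_(j < i) T j ^+ n i j).
    by case: i i0 hTj {nxi nyi yE Q0} => // i _ hTj; apply: umonomial_prod => // j /leqW/hTj.
  have M0 : \prod_(j < i) T j ^+ n i j != 0.
    by have [m [c [[_ [c0 _]] ->]]] := hM; rewrite mulf_neq0 // expf_neq0.
  exists (\prod_(j < i) T j ^+ n i j); split.
    by have [m [c [[Bc _] ->]]] := hM; apply: srM => //; apply: srX.
  by split=> //; split; [apply: supp | rewrite yE mulrC divfK].
(* The prime [yi = d * h] divides [d] or [h]. In the first case the support condition puts [x],
   hence [xi], in [(yi)], which is impossible; in the second [d] is a unit. *)
move=> d Bd nd [h [Bh yE']] hsupp; have yy := dvd_refl sB yi.
have [|Pd|[c [Bc hE]]] := (proj2 (proj2 py)) d h Bd Bh; first by rewrite -yE'.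
  have [_ [_ py3]] := py; have := hsupp _ py Pd.
  rewrite xE => /py3[]; [exact: srX | by case: ug | |].
    by move/(prime_power lB py Bx)/(reg_params_ndvd (reg_params_sym hB)).
  by move/(id_unit (proj1 py) ug); case: py => _ [].
apply: nd; have dc : 1 = d * c.
  by apply: (mulfI y0); rewrite mulr1 {1}yE' hE; ring.
split=> //; have d0 : d != 0 by apply/eqP => d0; move/eqP: dc; rewrite d0 mul0r oner_eq0.
by split=> //; rewrite (_ : d^-1 = c) //; apply: (mulfI d0); rewrite -dc divff.
Qed.

End Invariant.

(** * Gluing the stages into one sequence of transforms *)

Lemma dependent_sequence (X : Type) (P : nat -> X -> Prop) (R : nat -> X -> X -> Prop) a :
  P 0%N a -> (forall i b, P i b -> exists c, P i.+1 c /\ R i b c) ->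
  exists s, s 0%N = a /\ forall i, P i (s i) /\ R i (s i) (s i.+1).
Proof.
move=> Pa step.
pose s := fix s i := if i is i'.+1 then
  epsilon (inhabits a) (fun c => P i'.+1 c /\ R i' (s i') c) else a.
have sP i : P i (s i) -> P i.+1 (s i.+1) /\ R i (s i) (s i.+1).
  move=> Pi; exact: (epsilon_spec (inhabits a) (fun c => P i.+1 c /\ R i (s i) c) (step _ _ Pi)).
have Ps i : P i (s i) by elim: i => // i /sP[].
by exists s; split=> // i; split=> //; case: (sP i (Ps i)).
Qed.

Lemma eps_gt0 p q : (0 < p)%N -> (0 < q)%N -> (0 < eps p q)%N.
Proof.
by move=> p0 q0; case: (leqP q p) => ?; [rewrite eps_subl | rewrite eps_subr].
Qed.

Lemma algebraic_ring_const (k K : fieldType) (f : {rmorphism k -> K}) (S : K -> Prop) c :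
  algebraic_ring f S -> S (f c).
Proof.
move=> [s [P [[_ [P1 _]] SE]]]; apply/SE; exists (f c), (f 1); split; first exact: kalg_const.
by split; [apply: kalg_const | rewrite rmorph1 divr1].
Qed.

Theorem theorem7p5
  (k : closedFieldType) (hchar : [pchar k] =i pred0)
  (K : fieldType) (f : {rmorphism k -> K}) (htr : trdeg2 f)
  (nu : K -> rat) (hval : is_k_valuation f nu) (hres : residue_field_k f nu)
  (S : K -> Prop) (hSalg : algebraic_ring f S) (hSfrac : frac_field_is_K S)
  (hSdom : dominated nu S)
  (x y : K) (hxy : reg_params S x y) (hx : nu x = 1)
  (T : nat -> K) (p q : nat -> nat) (n : nat -> nat -> nat) (lam : nat -> k)
  (hT : jumping f nu x y T p q n lam) :
  exists Sq : nat -> K -> Prop,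
    (forall z, Sq 0%N z <-> S z) /\
    (forall m, quad_transform nu (Sq m) (Sq m.+1)) /\
    (forall i, (0 < i)%N ->
       is_free (Sq (kseq p q i)) x /\
       exists xi yi : K,
         reg_params (Sq (kseq p q i)) xi yi /\
         exceptional_param (Sq (kseq p q i)) x xi /\
         (forall j, (j <= i)%N ->
            exists e : nat, (e%:R : rat) = (Qprod q i)%:R * nu (T j) /\
            exists g, unitIn (Sq (kseq p q i)) g /\ T j = xi ^+ e * g) /\
         nu xi = ((Qprod q i)%:R)^-1 /\
         yi = T i.+1 / \prod_(j < i) T j ^+ n i j /\
         strict_transform (Sq (kseq p q i)) x (T i.+1) yi /\
         nu yi = ((Qprod q i)%:R)^-1 * ((p i.+1)%:R / (q i.+1)%:R)).
Proof.
have [T0 [T1 [hpq [nuy _]]]] := hT.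
have stage0 : stage f nu T p q n 0 S x y.
  have sS : subring S by case: hxy => -[].
  have Q0 : Qprod q 0 = 1%N by rewrite /Qprod big_geq.
  split=> //; split; first by split=> // c; apply: algebraic_ring_const hSalg.
  rewrite Q0 invr1 mul1r; do 2!split=> //; split.
    move=> j; rewrite leqn0 => /eqP ->; exists 1%N, 1; rewrite T0 mulr1; split=> //.
    exact: unitIn1.
  by split=> //; exists 1; rewrite T1 mulr1; split=> //; apply: umonomial1.
(* Only the first [kseq p q i] transforms of [R] are constrained, so the constant sequence [S]
   serves for [i = 0]. *)
pose P i (R : nat -> K -> Prop) := R 0%N = S /\
  (forall m, (m < kseq p q i)%N -> quad_transform nu (R m) (R m.+1)) /\
  exists xi yi, stage f nu T p q n i (R (kseq p q i)) xi yi.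
pose ext i (R R' : nat -> K -> Prop) := forall m, (m <= kseq p q i)%N -> R' m = R m.
have [s [_ hs]] : exists s, s 0%N = (fun=> S) /\ forall i, P i (s i) /\ ext i (s i) (s i.+1).
  apply: dependent_sequence => [|i R [R0 [Rq [xi [yi hR]]]]].
    by split=> //; split=> //; exists x, y.
  have [B [xi' [yi' [[C [C0 [CN Cq]]] hB]]]] := stage_step hval hres hT hR.
  pose k' := kseq p q i.
  (* Concatenation at index [k'], where both pieces give the same ring since [C 0 = R k']. *)
  exists (fun m => if (m <= k')%N then R m else C (m - k')%N); split; last by move=> m ->.
  split; first by [].
  have RC j : (if (k' + j <= k')%N then R (k' + j)%N else C (k' + j - k')%N) = C j.
    by case: j => [|j]; [rewrite addn0 leqnn C0 | rewrite addKn addnS ltnNge leq_addr].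
  split; last by exists xi', yi'; rewrite /= RC CN.
  move=> m /= mk; case: (ltnP m k') => [mk'|km]; first by rewrite ltnW //; apply: Rq.
  by rewrite -(subnKC km) -addnS !RC addKn; apply: Cq; rewrite ltn_subLR.
have kS i : (kseq p q i < kseq p q i.+1)%N.
  by have [p0 [q0 _]] := hpq i.+1 isT; rewrite /= -[X in (X < _)%N]addn0 ltn_add2l eps_gt0.
have k_ge i : (i <= kseq p q i)%N.
  by elim: i => // i IHi; apply: leq_ltn_trans IHi (kS i).
have s_ext i j m : (i <= j)%N -> (m <= kseq p q i)%N -> s j m = s i m.
  move=> /subnKC <-; elim: (j - i)%N => [|d IHd] mi; first by rewrite addn0.
  rewrite addnS -IHd //; apply: (proj2 (hs _)); apply: leq_trans mi _.
  by elim: d {IHd} => [|d IHd]; rewrite ?addn0 // addnS; apply: leq_trans IHd (ltnW (kS _)).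
(* The diagonal is stable: every [eps] is positive, so [m <= kseq p q m] and later sequences agree
   with [s m] at index [m]. *)
exists (fun m => s m m); split; first by case: (hs 0%N) => -[-> _].
split=> [m|i i0].
  rewrite -(s_ext m m.+1 m (leqnSn m) (k_ge m)).
  by have [[_ [h _]] _] := hs m.+1; apply: h; apply: k_ge.
have -> : s (kseq p q i) (kseq p q i) = s i (kseq p q i) by apply: s_ext.
have [[_ [_ [xi [yi hi]]]] _] := hs i.
have [hfree hc] := stage_conclusion hval hT hx i0 hi.
by split=> //; exists xi, yi.
Qed.
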